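(* In the moral hazard model and under the maintained assumptions described in the context, suppose that at least one of the following holds: (i) For every $W>w_0$, $\dfrac{A(W)}{P(W)}\ge \dfrac13$, and $\lim_{W\to\infty}\dfrac{A(W)}{u'(W)}=\infty$, where $A(W):=-u''(W)/u'(W)$ and $P(W):=-u'''(W)/u''(W)$; moreover $\underline c''>0$, $\mathrm{Curv}_{\mathrm{safe}}<\infty$, and $$\Bigl[\lim_{W\to\infty}u(W)-u(w_0)\Bigr]\,\mathrm{Cap}_{\mathrm{safe}}>c'(a_0);$$ (ii) $u(W)=\log W$ and $$\frac{\mathrm{Curv}_{\mathrm{safe}}}{\mathrm{Width}_{\mathrm{safe}}}<\underline c''.$$ Then there exists $U^*<U_R$ such that, for every $\bar U\in[U^*,U_R)$, the first-order approach is valid for $(a_0,\bar U)$. Moreover the relaxed cost-minimization problem with reservation utility $\bar U$ has a solution, which is unique up to $\nu$-null sets and which is $\nu$-almost everywhere equal to a canonical contract $w_{\lambda,\mu}$ for some multipliers $\lambda\ge 0$ and $\mu\in\mathbb R$.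
   Context: Model. Actions $a$ lie in a compact interval $\mathcal A\subseteq\mathbb R_+$, and $a_0$ is a fixed interior point of $\mathcal A$ (the intended action). Output $y$ lies in a common support $\mathcal Y$ and, given $a$, has a strictly positive density (or probability mass function) $f(y\mid a)$ with respect to a common dominating measure $\nu$. $w_0$ is initial wealth, $u:[w_0,\infty)\to\mathbb R$ is utility of final wealth, $c:\mathcal A\to\mathbb R$ is the cost of action. A contract is a measurable $w:\mathcal Y\to\mathbb R_+$. Put $$U(w,a)=\int u(w_0+w(y))f(y\mid a)\,d\nu(y)-c(a),\qquad C(w,a)=\int w(y)f(y\mid a)\,d\nu(y).$$ $\mathcal W$ is the set of contracts that have finite $C(w,a)$ and finite expected utility at every $a\in\mathcal A$ and that permit differentiation under the integral sign through second order, i.e. for $j=1,2$, $\frac{d^j}{da^j}\int u(w_0+w)f(y\mid a)\,d\nu=\int u(w_0+w)\,\partial_a^j f(y\mid a)\,d\nu$. Notation. $s(y):=f_a(y\mid a_0)/f(y\mid a_0)$ (score); $\underline c'':=\inf_{a\in\mathcal A}c''(a)$; $m_0:=1/u'(w_0)$; $L_0(z):=(u')^{-1}(1/z)$ for $z\ge m_0$; $L(z):=L_0(\max\{z,m_0\})$ for $z\in\mathbb R$. For $\lambda,\mu\in\mathbb R$, the canonical contract is $w_{\lambda,\mu}(y):=L(\lambda+\mu s(y))-w_0$. Maintained assumptions. For $\nu$-a.e. $y$, $a\mapsto f(y\mid a)$ is $C^2$. $u$ is $C^3$ with $u'>0$, $u''<0$, $\lim_{W\to\infty}u'(W)=0$.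 $c$ is $C^2$ and strictly convex with $c'(a_0)>0$. Every canonical contract belongs to $\mathcal W$, and its expected utility, local incentives and expected compensation cost ($U(w_{\lambda,\mu},a_0)$, $U_a(w_{\lambda,\mu},a_0)$, $C(w_{\lambda,\mu},a_0)$) are continuous in $(\lambda,\mu)$. Finally $[\lim_{W\to\infty}u(W)-u(w_0)]\int_{\{f_a(y\mid a_0)>0\}}f_a(y\mid a_0)\,d\nu(y)>c'(a_0)$. (Convention: $\infty\cdot 0=0$.) Problems. Given $\bar U\in\mathbb R$, the cost-minimization problem is to minimize $C(w,a_0)$ over $w\in\mathcal W$ subject to $U(w,a_0)\ge\bar U$ and $U(w,a_0)\ge U(w,a)$ for every $a\in\mathcal A$. The relaxed cost-minimization problem replaces the second constraint by $U_a(w,a_0)=0$. The first-order approach is valid for $(a_0,\bar U)$ if every solution of the relaxed problem also solves the cost-minimization problem. $U_R\in\mathbb R\cup\{\infty\}$ is the supremum of the $\bar U$ for which the relaxed problem is feasible. Safe low-score quantities. For $q\le 0$, $\{y:s(y)\le q\}$ is a safe low-score region if $f_{aa}(y\mid a)\ge0$ for every $a\in\mathcal A$ and $\nu$-a.e. $y$ in that region. $\mathcal Q_{\mathrm{safe}}$ is the set of $q\le0$ generating safe low-score regions, $\bar q_{\mathrm{safe}}:=\sup\mathcal Q_{\mathrm{safe}}$ ($\sup\varnothing=-\infty$, $\inf\varnothing=+\infty$), and, with $[x]_+=\max\{x,0\}$, $$\mathrm{Cap}_{\mathrm{safe}}:=-\int_{\{s(y)<\bar q_{\mathrm{safe}}\}}s(y)f(y\mid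 a_0)\,d\nu(y),\qquad \mathrm{Curv}_{\mathrm{safe}}:=\inf_{q\in\mathcal Q_{\mathrm{safe}}}\sup_{a\in\mathcal A}\int_{\{s(y)>q\}}[s(y)f_{aa}(y\mid a)]_+\,d\nu(y),$$ $$\mathrm{Width}_{\mathrm{safe}}:=\sup\bigl(\{0\}\cup\{q-\operatorname{ess\,inf}_{y\in\mathcal Y}s(y):q\in\mathcal Q_{\mathrm{safe}}\}\bigr).$$ The ratio $\mathrm{Curv}_{\mathrm{safe}}/\mathrm{Width}_{\mathrm{safe}}$ is $0$ when curvature is finite and width is infinite, and $\infty$ when curvature is infinite or width is zero. *)

(* Defs.v *)
From HB Require Import structures.
From mathcomp Require Import all_boot all_order all_algebra.
From mathcomp Require Import all_classical all_reals all_analysis ess_sup_inf.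

Set Implicit Arguments.
Unset Strict Implicit.
Unset Printing Implicit Defensive.

Import Order.TTheory GRing.Theory Num.Theory.
Import numFieldNormedType.Exports.

Local Open Scope classical_set_scope.
Local Open Scope ring_scope.

(* Differentiation relative to an interval: the difference quotient is taken
   along points of D only, so the derivative is the ordinary one in the interior
   of D and the one-sided one at an endpoint belonging to D. *)
Definition diff_quotient (R : realType) (g : R -> R) (x y : R) : R :=
  (g y - g x) / (y - x).

Definition derivable_in (R : realType) (D : set R) (g : R -> R) (x : R) : Prop :=
  cvg (diff_quotient g x y @[y --> within D x^']).

Definition deriv_in (R : realType) (D : set R) (g : R -> R) (x : R) : R :=
  lim (diff_quotient g x y @[y --> within D x^']).

Definition derivn_in (R : realType) (D : set R) (n : nat) (g : R -> R) : R -> R :=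
  iter n (deriv_in D) g.

Definition class_C (R : realType) (D : set R) (n : nat) (g : R -> R) : Prop :=
  (forall k, (k < n)%N -> forall x, D x -> derivable_in D (derivn_in D k g) x) /\
  (forall k, (k <= n)%N -> {within D, continuous (derivn_in D k g)}).

Definition strictly_convex_on (R : realType) (D : set R) (g : R -> R) : Prop :=
  forall x y t : R, D x -> D y -> x != y -> 0 < t < 1 ->
    g (t * x + (1 - t) * y) < t * g x + (1 - t) * g y.

(* The type Y is the common support. Only the values of dens _ a and cost a for
   a in [act_lo, act_hi], and of util W for W >= wealth0, are meaningful. *)
Record moral_hazard d (Y : measurableType d) (R : realType) := MoralHazard {
  dom_meas : {measure set Y -> \bar R} ;
  act_lo : R ;
  act_hi : R ;
  act0 : R ;
  dens : Y -> R -> R ;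
  wealth0 : R ;
  util : R -> R ;
  cost : R -> R ;
  act_lo_ge0 : 0 <= act_lo ;
  act0_interior : act_lo < act0 < act_hi ;
  dens_gt0 : forall y a, act_lo <= a <= act_hi -> 0 < dens y a ;
  dens_measurable : forall a, act_lo <= a <= act_hi ->
    measurable_fun [set: Y] (dens ^~ a) ;
  dens_mass : forall a, act_lo <= a <= act_hi ->
    (\int[dom_meas]_y (dens y a)%:E = 1)%E
}.

Section Model.
Context d (Y : measurableType d) (R : realType) (M : moral_hazard Y R).

Local Notation nu := (dom_meas M).
Local Notation f := (dens M).
Local Notation a0 := (act0 M).
Local Notation w0 := (wealth0 M).
Local Notation u := (util M).
Local Notation c := (cost M).

Definition actions : set R := `[act_lo M, act_hi M].

Definition wealths : set R := `[w0, +oo[.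

Definition dens_d (j : nat) (y : Y) (a : R) : R := derivn_in actions j (f y) a.

Definition util_d (j : nat) (W : R) : R := derivn_in wealths j u W.

Definition cost_d (j : nat) (a : R) : R := derivn_in actions j c a.

Definition gross_utility (w : Y -> R) (a : R) : R :=
  \int[nu]_y (u (w0 + w y) * f y a).

Definition agent_utility (w : Y -> R) (a : R) : R := gross_utility w a - c a.

Definition agent_incentive (w : Y -> R) (a : R) : R :=
  deriv_in actions (agent_utility w) a.

Definition expected_wage (w : Y -> R) (a : R) : R := \int[nu]_y (w y * f y a).

Record contract (w : Y -> R) : Prop := Contract {
  contract_measurable : measurable_fun [set: Y] w ;
  contract_ge0 : forall y, 0 <= w y ;
  contract_wage : forall a, actions a ->
    nu.-integrable [set: Y] (fun y => (w y * f y a)%:E) ;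
  contract_utility : forall a, actions a ->
    nu.-integrable [set: Y] (fun y => (u (w0 + w y) * f y a)%:E) ;
  contract_diff : forall (j : nat) (a : R), (0 < j <= 2)%N -> actions a ->
    [/\ derivable_in actions (derivn_in actions j.-1 (gross_utility w)) a,
        nu.-integrable [set: Y] (fun y => (u (w0 + w y) * dens_d j y a)%:E) &
        derivn_in actions j (gross_utility w) a =
          \int[nu]_y (u (w0 + w y) * dens_d j y a)]
}.

Definition score (y : Y) : R := dens_d 1 y a0 / f y a0.

Definition cost_curv : \bar R := ereal_inf [set (cost_d 2 a)%:E | a in actions].

Definition m0 : R := (util_d 1 w0)^-1.

(* (u')^-1 (1/z), a genuine inverse for z >= m0 under the maintained
   assumptions. *)
Definition L0 (z : R) : R := get [set W | wealths W /\ util_d 1 W = z^-1].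

Definition Lext (z : R) : R := L0 (Num.max z m0).

Definition canonical_contract (lambda mu : R) (y : Y) : R :=
  Lext (lambda + mu * score y) - w0.

Definition util_range : \bar R :=
  (lim ((u W)%:E @[W --> +oo%R]) - (u w0)%:E)%E.

(* Extended-real multiplication satisfies +oo * 0 = 0. *)
Record maintained : Prop := Maintained {
  dens_C2 : \forall y \ae nu, class_C actions 2 (f y) ;
  util_C3 : class_C wealths 3 u ;
  util_d1_gt0 : forall W, wealths W -> 0 < util_d 1 W ;
  util_d2_lt0 : forall W, wealths W -> util_d 2 W < 0 ;
  util_d1_cvg0 : util_d 1 W @[W --> +oo%R] --> (0 : R) ;
  cost_C2 : class_C actions 2 c ;
  cost_convex : strictly_convex_on actions c ;
  cost_d1_gt0 : 0 < cost_d 1 a0 ;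
  canonical_is_contract : forall lambda mu : R,
    contract (canonical_contract lambda mu) ;
  canonical_utility_continuous :
    continuous (fun p : R * R => agent_utility (canonical_contract p.1 p.2) a0) ;
  canonical_incentive_continuous :
    continuous (fun p : R * R =>
      agent_incentive (canonical_contract p.1 p.2) a0) ;
  canonical_wage_continuous :
    continuous (fun p : R * R => expected_wage (canonical_contract p.1 p.2) a0) ;
  incentive_capacity : ((cost_d 1 a0)%:E <
    util_range * \int[nu]_(y in [set y | (0 < dens_d 1 y a0)%R])
                   (dens_d 1 y a0)%:E)%E
}.

Definition cmp_feasible (Ubar : R) (w : Y -> R) : Prop :=
  [/\ contract w, Ubar <= agent_utility w a0 &
      forall a, actions a -> agent_utility w a <= agent_utility w a0].

Definition relaxed_feasible (Ubar : R) (w : Y -> R) : Prop :=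
  [/\ contract w, Ubar <= agent_utility w a0 & agent_incentive w a0 = 0].

Definition cmp_solution (Ubar : R) (w : Y -> R) : Prop :=
  cmp_feasible Ubar w /\
  forall v, cmp_feasible Ubar v -> expected_wage w a0 <= expected_wage v a0.

Definition relaxed_solution (Ubar : R) (w : Y -> R) : Prop :=
  relaxed_feasible Ubar w /\
  forall v, relaxed_feasible Ubar v -> expected_wage w a0 <= expected_wage v a0.

Definition foa_valid (Ubar : R) : Prop :=
  forall w, relaxed_solution Ubar w -> cmp_solution Ubar w.

Definition relaxed_sup : \bar R :=
  ereal_sup [set Ubar%:E | Ubar in [set Ubar : R | exists w, relaxed_feasible Ubar w]].

Definition safe_scores : set R :=
  [set q | q <= 0 /\ forall a, actions a ->
     \forall y \ae nu, score y <= q -> 0 <= dens_d 2 y a].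

Definition safe_score_sup : \bar R := ereal_sup [set q%:E | q in safe_scores].

Definition Cap_safe : \bar R :=
  (- \int[nu]_(y in [set y | (score y)%:E < safe_score_sup])
       (score y * f y a0)%:E)%E.

Definition Curv_safe : \bar R :=
  ereal_inf [set ereal_sup
      [set (\int[nu]_(y in [set y | (q < score y)%R])
              (Num.max (score y * dens_d 2 y a) 0)%:E)%E | a in actions]
    | q in safe_scores].

Definition Width_safe : \bar R :=
  ereal_sup ([set 0%E] `|`
    [set (q%:E - ess_inf nu (EFin \o score))%E | q in safe_scores]).

Definition curv_width_ratio : \bar R :=
  (if (Curv_safe == +oo) || (Width_safe == 0) then +oo
   else if Width_safe == +oo then 0
   else (fine Curv_safe / fine Width_safe)%:E)%E.

Definition risk_aversion (W : R) : R := - util_d 2 W / util_d 1 W.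

Definition prudence (W : R) : R := - util_d 3 W / util_d 2 W.

(* Division being total (x / 0 = 0), the lower bound on the ratio of risk
   aversion to prudence includes that prudence is nonzero. *)
Definition general_condition : Prop :=
  (forall W, w0 < W -> 3^-1 <= risk_aversion W / prudence W) /\
  (risk_aversion W / util_d 1 W @[W --> +oo%R] --> +oo%R) /\
  (0 < cost_curv)%E /\
  (Curv_safe < +oo)%E /\
  ((cost_d 1 a0)%:E < util_range * Cap_safe)%E.

Definition log_condition : Prop :=
  (forall W, wealths W -> u W = ln W) /\ (curv_width_ratio < cost_curv)%E.

End Model.

(* Main.v *)
Require Import Defs.
From mathcomp Require Import all_boot all_order all_algebra.
From mathcomp Require Import all_classical all_reals all_analysis.
From mathcomp Require Import ess_sup_inf measurable_realfun ring lra.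

(* Let h(z) = u(L(z)) be the utility paid by a canonical contract at index
   z = lambda + mu s(y). For each large lambda there is exactly one mu > 0 that
   makes the incentive constraint bind, it depends continuously on lambda, and by
   the Lagrangian inequality the resulting contract solves the relaxed problem at
   its own utility level V(lambda). The same inequality gives
   V(lambda) >= U(v) - C(v) / lambda for every relaxed-feasible v, so V is
   continuous, increasing and tends to U_R, and every level close to U_R is
   attained.
   Either alternative provides scores q' < q with q safe such that punishing only
   {s <= q'} at a high utility level already creates more incentives than c'(a0).
   Hence lambda + mu q' > m0: the punishment region of the optimal contract lies
   below q', so that z := lambda + mu q >= mu (q - q') and z -> oo. Since
   int f_aa = 0, int u f_aa = int (h(lambda + mu s) - h(lambda)) f_aa; the safe
   region contributes a nonpositive amount, and above q the function h is
   (K/z)-Lipschitz, with K arbitrarily small in case (i) and K = 1 for log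
   utility. So int u f_aa <= K Curv / (q - q') <= c'', expected utility is concave
   in the action, and the first-order condition at a0 is sufficient. *)

Set Implicit Arguments.
Unset Strict Implicit.
Unset Printing Implicit Defensive.

Import Order.TTheory GRing.Theory Num.Theory.
Import numFieldNormedType.Exports.

Local Open Scope classical_set_scope.
Local Open Scope ring_scope.

(** * Derivatives relative to an interval *)

Section RelativeDerivative.
Context {R : realType}.
Implicit Types (D : set R) (g : R -> R).

Lemma within_interior D x : nbhs x D -> within D x^' = x^'.
Proof.
move=> nD; apply/seteqP; split => P /= PP.
- rewrite /within/= in PP; have nD' : x^' D by exact: nbhs_dnbhs.
  by apply: filterS2 nD' PP => y Dy; exact.
- by apply: filterS PP => y Py _.
Qed.

(** Away from the endpoints of [D] the relative derivative is the ordinary one; this gives access to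
    [MVT], the rules for [is_derive] and the first-order condition at a maximum. *)
Lemma derivable_in_interior D g x : nbhs x D -> derivable_in D g x ->
  is_derive x 1 g (deriv_in D g x).
Proof.
move=> nD; rewrite /derivable_in /deriv_in (within_interior nD) => cg.
set l := lim _ in cg *.
have cv : h^-1 *: (g (h *: (1 : R^o) + x) - g x) @[h --> 0^'] --> l.
  apply/cvgrPdist_lt => e e0; move/cvgrPdist_lt: cg => /(_ e e0) [r/= r0 Hr].
  exists r => //= h /= hr h0; have := Hr (h + x).
  rewrite /diff_quotient addrK.
  have -> : h *: (1 : R^o) = h :> R by exact: mulr1.
  rewrite mulrC /= => {}Hr; apply: Hr.
    by move: hr; rewrite /= sub0r opprD addrCA subrr addr0.
  by apply: contra_neq h0 => hx; apply: (addIr x); rewrite add0r.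
by apply: DeriveDef; [apply: cvgP cv| rewrite /derive; exact: cvg_lim].
Qed.

Lemma derivable_in_continuous D g : (forall x, D x -> derivable_in D g x) ->
  {within D, continuous g}.
Proof.
move=> dg; apply/subspace_continuousP => x Dx.
apply/cvgrPdist_lt => e e0.
(* With tolerance 1 the difference quotient is bounded by [|l| + 1] near [x], so [g] is Lipschitz at
   [x] relative to [D]. *)
have /cvgrPdist_lt/(_ 1 ltr01) := dg x Dx.
set l := lim _; rewrite !near_withinE => -[r/= r0 Hr].
have K0 : 0 < `|l| + 1 by rewrite ltr_wpDl.
near=> y => Dy; have [->|yx] := eqVneq y x; first by rewrite subrr normr0.
have xy : `|x - y| < r by near: y; apply: cvgr_dist_lt => //; exact: cvg_id.
have := Hr y xy yx Dy; rewrite /diff_quotient => h1.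
have xye : `|x - y| < e / (`|l| + 1).
  near: y; apply: cvgr_dist_lt; [exact: cvg_id|exact: divr_gt0].
have -> : g x - g y = (g y - g x) / (y - x) * (x - y).
  by rewrite -(opprB y x) mulrN divfK ?subr_eq0// opprB.
rewrite normrM (@le_lt_trans _ _ ((`|l| + 1) * `|x - y|))//.
  rewrite ler_wpM2r// -[X in `|X|](subKr l) (le_trans (ler_normB _ _))//.
  by rewrite lerD2l ltW.
by rewrite mulrC -ltr_pdivlMr.
Unshelve. all: by end_near. Qed.

(** The points [x] and [y] may be endpoints of [D]: only continuity is used there, while every point
    of []x, y[] is interior to [D]. *)
Lemma MVT_in D g x y : (forall z, D z -> derivable_in D g z) ->
  `[x, y] `<=` D -> x < y ->
  exists2 z, z \in `]x, y[ & g y - g x = deriv_in D g z * (y - x).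
Proof.
move=> dg xyD xy; apply: MVT => //.
- move=> z zxy; apply: derivable_in_interior; last first.
    by apply/dg/xyD => /=; apply: subset_itvW zxy.
  near=> t; apply: xyD => /=; apply: (@subset_itv_oo_cc _ _ x y).
  by near: t; exact: near_in_itvoo.
- apply: (@continuous_subspaceW _ _ _ D) => //.
  exact: derivable_in_continuous.
Unshelve. all: by end_near. Qed.

Lemma deriv_inB D g h x : nbhs x D -> derivable_in D g x -> derivable_in D h x ->
  deriv_in D (fun y => g y - h y) x = deriv_in D g x - deriv_in D h x.
Proof.
move=> nD; rewrite /derivable_in /deriv_in (within_interior nD) => cg ch.
apply: cvg_lim => //; rewrite [X in X @ _ --> _](_ : _ =
  fun y => diff_quotient g x y - diff_quotient h x y); first exact: cvgB.
by apply/funext => y; rewrite /diff_quotient -mulrBl; congr (_ / _); lra.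
Qed.

Lemma derivable_inB D g h x : derivable_in D g x -> derivable_in D h x ->
  derivable_in D (fun y => g y - h y) x.
Proof.
rewrite /derivable_in => cg ch.
rewrite [X in cvg (X @ _)](_ : _ =
  fun y => diff_quotient g x y - diff_quotient h x y); first exact: is_cvgB.
by apply/funext => y; rewrite /diff_quotient -mulrBl; congr (_ / _); lra.
Qed.

Lemma deriv_in_near_cst D g k x : nbhs x D -> (\forall y \near x, g y = k) ->
  deriv_in D g x = 0.
Proof.
move=> nD gk; rewrite /deriv_in (within_interior nD).
apply: cvg_lim => //; apply: cvg_near_cst.
have := nbhs_dnbhs gk; apply: filterS => y gy.
by rewrite /diff_quotient gy (nbhs_singleton gk) subrr mul0r.
Qed.

End RelativeDerivative.

(** * Utility and the inverse marginal utility *)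

Section Utility.
Context {d} {Y : measurableType d} {R : realType} {M : moral_hazard Y R}.
Hypothesis HM : maintained M.
Local Notation u := (util M).
Local Notation w0 := (wealth0 M).
Local Notation u' := (util_d M 1).
Local Notation m0 := (m0 M).
Local Notation Lext := (Lext M).

Lemma wealthsE W : wealths M W = (w0 <= W).
Proof. by rewrite /wealths/= in_itv/= andbT. Qed.

Lemma util_derivable W : wealths M W -> derivable_in (wealths M) u W.
Proof. by move=> hW; apply: ((util_C3 HM).1 0%N). Qed.

Lemma util_d1_derivable W : wealths M W -> derivable_in (wealths M) u' W.
Proof. by move=> hW; apply: ((util_C3 HM).1 1%N). Qed.

Lemma wealths_sub x y : w0 <= x -> `[x, y] `<=` wealths M.
Proof.
by move=> wx z /=; rewrite wealthsE in_itv/= => /andP[xz _]; exact: le_trans xz.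
Qed.

Lemma util_d1_decr x y : w0 <= x -> x < y -> u' y < u' x.
Proof.
move=> wx xy; have [z + e] := MVT_in util_d1_derivable (wealths_sub wx) xy.
rewrite in_itv/= => /andP[xz zy]; rewrite -subr_lt0 e pmulr_llt0 ?subr_gt0//.
by apply: (util_d2_lt0 HM); rewrite wealthsE (le_trans wx)// ltW.
Qed.

Lemma util_MVT x y : w0 <= x -> x < y ->
  exists2 z, x < z < y & u y - u x = u' z * (y - x).
Proof.
move=> wx xy; have [z + e] := MVT_in util_derivable (wealths_sub wx) xy.
by rewrite in_itv/=; exists z.
Qed.

Lemma util_incr x y : w0 <= x -> x < y -> u x < u y.
Proof.
move=> wx xy; have [z /andP[xz zy] e] := util_MVT wx xy.
rewrite -subr_gt0 e mulr_gt0 ?subr_gt0//.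
by apply: (util_d1_gt0 HM); rewrite wealthsE (le_trans wx)// ltW.
Qed.

Lemma util_mono x y : w0 <= x -> x <= y -> u x <= u y.
Proof.
move=> wx; rewrite le_eqVlt => /predU1P[->//|xy].
by rewrite ltW// util_incr.
Qed.

Lemma m0_gt0 : 0 < m0.
Proof. by rewrite /Defs.m0 invr_gt0 (util_d1_gt0 HM)// wealthsE. Qed.

Lemma maxm0_gt0 z : 0 < Num.max z m0.
Proof. by rewrite lt_max m0_gt0 orbT. Qed.

(** [get] returns a genuine solution: [u'] is continuous on [wealths], equals [m0^-1] at [w0] and
    tends to 0, so it takes the value [Z^-1] whenever [Z >= m0]. *)
Lemma Lext_spec z : w0 <= Lext z /\ u' (Lext z) = (Num.max z m0)^-1.
Proof.
rewrite /Defs.Lext /L0 -wealthsE; set P := [set W | _].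
suff : P (get P) by [].
apply: getPex; rewrite /P/=.
set Z := Num.max z m0; have Z0 : 0 < Z := maxm0_gt0 z.
have [W1 w1 uW1] : exists2 W, w0 <= W & u' W < Z^-1.
  near (pinfty_nbhs R) => W; exists W; first by near: W; apply: nbhs_pinfty_ge; exact: num_real.
  by near: W; apply: (cvgr_lt (0 : R)); [exact: (util_d1_cvg0 HM)|rewrite invr_gt0].
have cu : {within `[w0, W1], continuous u'}.
  apply: (@continuous_subspaceW _ _ _ (wealths M)); first exact: wealths_sub.
  exact: ((util_C3 HM).2 1%N).
have hm : Z^-1 <= u' w0.
  by rewrite -[u' w0]invrK lef_pV2 ?posrE ?m0_gt0// le_max lexx orbT.
have [|W + uW] := @IVT R u' w0 W1 Z^-1 w1 cu.
  by rewrite ge_min le_max hm (ltW uW1) orbT.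
by rewrite in_itv/= => /andP[hW _]; exists W => //; split => //; rewrite wealthsE.
Unshelve. all: by end_near. Qed.

Lemma Lext_ge z : w0 <= Lext z. Proof. by have [] := Lext_spec z. Qed.

Lemma util_d1_inj x y : w0 <= x -> w0 <= y -> u' x = u' y -> x = y.
Proof.
move=> wx wy e; case: (ltgtP x y) => // xy.
- by have := util_d1_decr wx xy; rewrite e ltxx.
- by have := util_d1_decr wy xy; rewrite e ltxx.
Qed.

Lemma Lext_le_m0 z : z <= m0 -> Lext z = w0.
Proof.
move=> zm; apply: util_d1_inj => //; first exact: Lext_ge.
by rewrite (Lext_spec z).2 max_r// /Defs.m0 invrK.
Qed.

Lemma Lext_incr x y : m0 <= x -> x < y -> Lext x < Lext y.
Proof.
move=> mx xy; rewrite ltNge; apply/negP; rewrite le_eqVlt => /predU1P[e|lt].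
  have := (Lext_spec y).2; rewrite e (Lext_spec x).2 => /invr_inj.
  by rewrite !max_l// ?(le_trans mx (ltW xy))// => exy; rewrite exy ltxx in xy.
have := util_d1_decr (Lext_ge y) lt; rewrite !(Lext_spec _).2.
rewrite ltf_pV2 ?posrE ?maxm0_gt0// !max_l// ?(le_trans mx (ltW xy))// => yx.
by have := lt_trans xy yx; rewrite ltxx.
Qed.

Lemma Lext_mono x y : x <= y -> Lext x <= Lext y.
Proof.
move=> xy; have [xm|mx] := leP x m0; first by rewrite Lext_le_m0// Lext_ge.
move: xy; rewrite le_eqVlt => /predU1P[->//|xy].
by rewrite ltW// Lext_incr// ltW.
Qed.

Lemma Lext_util_d1 W : w0 <= W -> Lext (u' W)^-1 = W.
Proof.
move=> wW; apply: util_d1_inj => //; first exact: Lext_ge.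
have uW : 0 < u' W by rewrite (util_d1_gt0 HM)// wealthsE.
rewrite (Lext_spec _).2 max_l ?invrK//.
rewrite /Defs.m0 lef_pV2 ?posrE ?(util_d1_gt0 HM) ?wealthsE//.
move: wW; rewrite le_eqVlt => /predU1P[->//|wW].
by rewrite ltW// util_d1_decr.
Qed.

(* Applied at z = lambda + mu s(y), this minimises the Lagrangian pointwise;
   strictness yields uniqueness of the optimal contract up to null sets. *)
Lemma Lext_optimal z W : w0 <= W -> W != Lext z ->
  Lext z - z * u (Lext z) < W - z * u W.
Proof.
move=> wW; have [wX uX] := Lext_spec z; set X := Lext z in wX uX *.
have Z0 := maxm0_gt0 z; set Z := Num.max z m0 in Z0 uX.
rewrite neq_lt => /orP[WX|XW].
(* Since [w0 <= W < X], the truncation at [m0] is inactive. Hence [u' X = 1/z], and marginal utility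
   exceeds [1/z] between [W] and [X]. *)
- have zm : m0 < z.
    rewrite ltNge; apply/negP => /Lext_le_m0 e.
    by have := le_lt_trans wW WX; rewrite /X e ltxx.
  have zZ : Z = z by rewrite /Z max_l// ltW.
  have [t /andP[Wt tX] e] := util_MVT wW WX.
  have ut := util_d1_decr (le_trans wW (ltW Wt)) tX.
  rewrite uX zZ in ut; have z0 : 0 < z by rewrite -zZ.
  have : X - W < z * (u X - u W).
    by rewrite e mulrA ltr_pMl ?subr_gt0// mulrC -ltr_pdivrMr// div1r.
  by rewrite mulrBr; lra.
(* Above [X] marginal utility is below [1/Z], which is at most [1/z] if [z > 0]; for [z <= 0] the
   product [z * u' t] is nonpositive, hence below 1. *)
- have [t /andP[Xt tW] e] := util_MVT wX XW.
  have ut := util_d1_decr wX Xt; rewrite uX in ut.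
  have ut0 : 0 < u' t.
    by rewrite (util_d1_gt0 HM)// wealthsE (le_trans wX)// ltW.
  suff : z * (u W - u X) < W - X by rewrite mulrBr; lra.
  rewrite e mulrA gtr_pMl ?subr_gt0//.
  have [z0|z0] := leP z 0; first by rewrite (le_lt_trans _ ltr01)// mulr_le0_ge0// ltW.
  rewrite mulrC -ltr_pdivlMr// div1r (lt_le_trans ut)// lef_pV2 ?posrE//.
  by rewrite le_max lexx.
Qed.

End Utility.

(** * Integrals of real-valued functions *)

Section RealIntegrals.
Context {d} {T : measurableType d} {R : realType} {mu : {measure set T -> \bar R}}.
Implicit Types f g : T -> R.
Local Notation intble f := (mu.-integrable [set: T] (fun x => (f x)%:E)).

Lemma integrable_measurable f : intble f -> measurable_fun [set: T] f.
Proof. by move=> /integrableP[mf _]; exact/measurable_EFinP. Qed.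

Lemma integrable_realD f g : intble f -> intble g -> intble (fun x => f x + g x).
Proof. by move=> fi gi; have := integrableD measurableT fi gi. Qed.

Lemma integrable_realB f g : intble f -> intble g -> intble (fun x => f x - g x).
Proof. by move=> fi gi; have := integrableB measurableT fi gi. Qed.

Lemma integrable_realZ (k : R) f : intble f -> intble (fun x => k * f x).
Proof. by move=> fi; have := integrableZl measurableT k fi. Qed.

Lemma ae_eq_Rintegral f g : measurable_fun [set: T] f ->
  measurable_fun [set: T] g -> (\forall x \ae mu, f x = g x) ->
  \int[mu]_x f x = \int[mu]_x g x.
Proof.
move=> mf mg fg; rewrite /Rintegral; congr fine.
apply: ae_eq_integral => //; [exact/measurable_EFinP|exact/measurable_EFinP|].
by apply: filterS fg => x -> _.
Qed.

(** Reduces to a pointwise bound: [f] agrees almost everywhere with [min f g], which is integrable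
    because [|f| + |g|] dominates it. *)
Lemma ae_le_Rintegral f g : intble f -> intble g ->
  (\forall x \ae mu, f x <= g x) -> \int[mu]_x f x <= \int[mu]_x g x.
Proof.
move=> fi gi fg; have mf := integrable_measurable fi.
have mg := integrable_measurable gi.
have mm : measurable_fun [set: T] (fun x => Num.min (f x) (g x)).
  exact: measurable_minr.
rewrite (@ae_eq_Rintegral f (fun x => Num.min (f x) (g x)))//; last first.
  by apply: filterS fg => x fgx; rewrite min_l.
apply: le_Rintegral => //; last by move=> x _; rewrite ge_min lexx orbT.
have := integrable_realD (integrable_norm fi) (integrable_norm gi).
apply: le_integrable => //; first exact/measurable_EFinP.
move=> x _ /=; rewrite lee_fin (ger0_norm (addr_ge0 _ _))//.
by have [_|_] := leP (f x) (g x); rewrite ?lerDl ?lerDr.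
Qed.

(** The nonnegative function [g - f] has zero integral, so it vanishes almost everywhere. This is
    the source of uniqueness and of strict monotonicity below. *)
Lemma Rintegral_eq_ae f g : intble f -> intble g -> (forall x, f x <= g x) ->
  \int[mu]_x g x <= \int[mu]_x f x -> \forall x \ae mu, f x = g x.
Proof.
move=> fi gi fg gf; have dgi := integrable_realB gi fi.
have : (\int[mu]_x `|(g x - f x)%:E| = 0)%E.
  under eq_integral do rewrite gee0_abs ?lee_fin ?subr_ge0//.
  have fin : (\int[mu]_x (g x - f x)%:E)%E \is a fin_num by exact: integrable_fin_num.
  rewrite -(fineK fin) -/(Rintegral _ _ _) RintegralB//.
  apply/eqP; rewrite eqe subr_eq0 eq_le gf/= le_Rintegral//.
move=> /ae_eq_integral_abs => /(_ measurableT).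
case; first by have /integrableP[] := dgi.
move=> N [mN N0 sN]; exists N; split => // x /= fx; apply: sN => /= e.
by apply: fx; have [] := e I => /subr0_eq.
Qed.

End RealIntegrals.

(** * The Lagrangian of the relaxed problem *)

Section Model.
Context {d} {Y : measurableType d} {R : realType} {M : moral_hazard Y R}.
Hypothesis HM : maintained M.
Local Notation nu := (dom_meas M).
Local Notation f := (dens M).
Local Notation a0 := (act0 M).
Local Notation u := (util M).
Local Notation c := (cost M).
Local Notation w0 := (wealth0 M).
Local Notation s := (score M).
Local Notation m0 := (m0 M).
Local Notation Lext := (Lext M).
Local Notation can := (canonical_contract M).
Local Notation intble g := (nu.-integrable [set: Y] (fun y => (g y)%:E)).

Definition canonical_util z := u (Lext z).
Local Notation h := canonical_util.

Lemma util_canonical lambda mu y :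
  u (w0 + can lambda mu y) = h (lambda + mu * s y).
Proof. by rewrite /canonical_contract addrC subrK. Qed.

Lemma canonical_util_mono x y : x <= y -> h x <= h y.
Proof. by move=> xy; apply: util_mono => //; [exact: Lext_ge|exact: Lext_mono]. Qed.

Lemma canonical_util_incr x y : m0 <= x -> x < y -> h x < h y.
Proof. by move=> mx xy; apply: util_incr => //; [exact: Lext_ge|exact: Lext_incr]. Qed.

Lemma canonical_util_le_m0 x : x <= m0 -> h x = u w0.
Proof. by move=> xm; rewrite /h Lext_le_m0. Qed.

Lemma interior_nbhs a : act_lo M < a < act_hi M -> nbhs a (actions M).
Proof.
move=> /andP[la ah]; near=> t; rewrite /actions/= in_itv/=.
by rewrite !ltW//; near: t; [exact: lt_nbhsl|exact: lt_nbhsr].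
Unshelve. all: by end_near. Qed.

Lemma act0_nbhs : nbhs a0 (actions M).
Proof. exact: interior_nbhs (act0_interior M). Qed.

Lemma act0_in : actions M a0.
Proof. exact: nbhs_singleton act0_nbhs. Qed.

Lemma actionsP a : actions M a <-> act_lo M <= a <= act_hi M.
Proof. by rewrite /actions/= in_itv. Qed.

Lemma interior_actions a : act_lo M < a < act_hi M -> actions M a.
Proof. by move=> /andP[/ltW la /ltW ah]; apply/actionsP/andP. Qed.

Lemma dens0_gt0 y : 0 < f y a0.
Proof. by apply: dens_gt0; apply/actionsP; exact: act0_in. Qed.

Lemma dens_integrable a : actions M a -> intble (f ^~ a).
Proof.
move=> /actionsP Aa; apply/integrableP; split.
  by apply/measurable_EFinP; exact: dens_measurable.
under eq_integral do rewrite gee0_abs ?lee_fin ?ltW ?dens_gt0//.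
by rewrite dens_mass// ltry.
Qed.

Lemma dens_mass1 a : actions M a -> \int[nu]_y f y a = 1.
Proof. by move=> /actionsP Aa; rewrite /Rintegral dens_mass. Qed.

(** With [mu = 0] the wage does not depend on output. These constant contracts serve as test
    contracts for the facts on [dens_d] that follow. *)
Lemma gross_utility_cst lambda a : actions M a ->
  gross_utility M (can lambda 0) a = h lambda.
Proof.
move=> Aa; rewrite /gross_utility.
under eq_Rintegral do rewrite util_canonical mul0r addr0.
by rewrite RintegralZl ?dens_mass1 ?mulr1//; exact: dens_integrable.
Qed.

Lemma canonical_util_neq0 : exists lambda, h lambda != 0.
Proof.
have [e|] := eqVneq (h m0) 0; last by exists m0.
exists (m0 + 1); rewrite gt_eqF// -e; apply: canonical_util_incr => //.
by rewrite ltrDl.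
Qed.

(** Integrability is assumed only for utility times [dens_d]; a constant contract with nonzero
    utility [h l] allows dividing by [h l]. *)
Lemma dens_d_integrable j a : (0 < j <= 2)%N -> actions M a ->
  intble (dens_d M j ^~ a).
Proof.
move=> j2 Aa; have [l l0] := canonical_util_neq0.
have [_ + _] := contract_diff (canonical_is_contract HM l 0) j2 Aa.
move=> /(integrable_realZ (h l)^-1); apply: eq_integrable => // y _.
by rewrite util_canonical mul0r addr0 mulKf.
Qed.

(** The gross utility of a constant contract is constant in the action, so its derivatives vanish;
    differentiation under the integral sign equates them with [h l] times the integral. *)
Lemma dens_d_int0 j a : (0 < j <= 2)%N -> act_lo M < a < act_hi M ->
  \int[nu]_y dens_d M j y a = 0.
Proof.
move=> j2 Aa; have [l l0] := canonical_util_neq0.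
have [_ _] := contract_diff (canonical_is_contract HM l 0) j2 (interior_actions Aa).
under eq_Rintegral do rewrite util_canonical mul0r addr0.
rewrite RintegralZl//; last exact: dens_d_integrable (interior_actions Aa).
have near_cst b : act_lo M < b < act_hi M ->
    \forall y \near b, gross_utility M (can l 0) y = h l.
  by move=> /interior_nbhs; apply: filterS => y; exact: gross_utility_cst.
have near_int : \forall y \near a, act_lo M < y < act_hi M.
  have Aa' : a \in `]act_lo M, act_hi M[ by rewrite in_itv.
  by apply: filterS (near_in_itvoo Aa') => y; rewrite in_itv.
have d0 b : act_lo M < b < act_hi M ->
    deriv_in (actions M) (gross_utility M (can l 0)) b = 0.
  by move=> Ab; apply: deriv_in_near_cst; [exact: interior_nbhs|exact: near_cst].
have -> : derivn_in (actions M) j (gross_utility M (can l 0)) a = 0.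
  case: j j2 => [|[|[|]]]// _; first exact: d0.
  apply: (@deriv_in_near_cst _ _ _ 0); first exact: interior_nbhs.
  by apply: filterS near_int => y; exact: d0.
by move=> /esym/eqP; rewrite mulf_eq0 (negPf l0)/= => /eqP.
Qed.

Lemma score_mul y : s y * f y a0 = dens_d M 1 y a0.
Proof. by rewrite /score divfK// gt_eqF// dens0_gt0. Qed.

Lemma score_measurable : measurable_fun [set: Y] s.
Proof.
apply: measurable_funM.
  exact: integrable_measurable (dens_d_integrable _ act0_in).
have mf := integrable_measurable (dens_integrable act0_in).
(* The reciprocal of the positive density is [exp (- ln f)], a composition of measurable maps. *)
rewrite [X in measurable_fun _ X](_ : _ = expR \o (-%R \o (@ln R \o (f ^~ a0)))).
  do 2 apply: measurableT_comp => //.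
  exact: measurableT_comp.
by apply/funext => y /=; rewrite expRN lnK// posrE dens0_gt0.
Qed.

Lemma measurable_score_le q : measurable [set y | s y <= q].
Proof.
rewrite -[X in measurable X]setTI.
exact: (measurable_fun_ler score_measurable (measurable_cst _)
  measurableT (Y := [set true])).
Qed.

Lemma measurable_score_gt q : measurable [set y | q < s y].
Proof.
rewrite -[X in measurable X]setTI.
exact: (measurable_fun_ltr (measurable_cst _) score_measurable
  measurableT (Y := [set true])).
Qed.

Lemma agent_incentiveE w : Defs.contract M w ->
  agent_incentive M w a0 =
  \int[nu]_y (u (w0 + w y) * dens_d M 1 y a0) - cost_d M 1 a0.
Proof.
move=> cw; have [dg _ <-] := contract_diff cw (isT : (0 < 1 <= 2)%N) act0_in.
rewrite /agent_incentive deriv_inB//; first exact: act0_nbhs.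
by apply: ((cost_C2 HM).1 0%N) => //; exact: act0_in.
Qed.

Definition lagrangian lambda mu w :=
  expected_wage M w a0 - lambda * agent_utility M w a0 -
  mu * agent_incentive M w a0.

(** Since [f_a = s f], the Lagrangian is, up to constants, the integral of [(W - z u(W)) f] with
    [W = w0 + v y] and [z = lambda + mu s(y)]. By [Lext_optimal] the canonical contract minimises
    this integrand at each [y], strictly against any other wage. *)
Lemma lagrangian_min lambda mu v : Defs.contract M v ->
  lagrangian lambda mu (can lambda mu) <= lagrangian lambda mu v /\
  (lagrangian lambda mu v <= lagrangian lambda mu (can lambda mu) ->
   \forall y \ae nu, v y = can lambda mu y).
Proof.
move=> cv; set w := can lambda mu.
have cw : Defs.contract M w := canonical_is_contract HM lambda mu.
pose P x y := x y * f y a0 - lambda * (u (w0 + x y) * f y a0) -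
  mu * (u (w0 + x y) * dens_d M 1 y a0).
have Pi x : Defs.contract M x -> intble (P x).
  move=> cx; have [_ i3 _] := contract_diff cx (isT : (0 < 1 <= 2)%N) act0_in.
  exact: (integrable_realB (integrable_realB (contract_wage cx act0_in)
    (integrable_realZ lambda (contract_utility cx act0_in)))
    (integrable_realZ mu i3)).
have PE x : Defs.contract M x -> lagrangian lambda mu x =
    \int[nu]_y P x y + lambda * c a0 + mu * cost_d M 1 a0.
  move=> cx.
  have i1 := contract_wage cx act0_in; have i2 := contract_utility cx act0_in.
  have [_ i3 _] := contract_diff cx (isT : (0 < 1 <= 2)%N) act0_in.
  rewrite /lagrangian agent_incentiveE// /agent_utility /P.
  have i2' := integrable_realZ lambda i2; have i3' := integrable_realZ mu i3.
  rewrite RintegralB//; last exact: (integrable_realB i1 i2').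
  by rewrite RintegralB// !RintegralZl// /expected_wage /gross_utility; lra.
have PW x y : P x y = ((w0 + x y) - (lambda + mu * s y) * u (w0 + x y) - w0) * f y a0.
  by rewrite /P -score_mul; lra.
have wE y : w0 + w y = Lext (lambda + mu * s y).
  by rewrite /w /canonical_contract addrC subrK.
have Plt y : v y != w y -> P w y < P v y.
  move=> vw; rewrite !PW ltr_pM2r ?dens0_gt0// ltrD2r wE.
  apply: Lext_optimal => //; first by rewrite lerDl (contract_ge0 cv).
  by rewrite -wE; apply: contra_neq vw => /addrI.
have Ple y : P w y <= P v y.
  have [vw|/Plt/ltW//] := eqVneq (v y) (w y); by rewrite /P vw.
rewrite !PE//; split.
  by rewrite !lerD2r; apply: le_Rintegral => //; exact: Pi.
rewrite !lerD2r => /(Rintegral_eq_ae (Pi _ cw) (Pi _ cv) Ple).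
apply: filterS => y e; apply/eqP; apply: contraT => /Plt.
by rewrite e ltxx.
Qed.

End Model.

(** * Incentives and concavity of expected utility *)

Section Incentives.
Context {d} {Y : measurableType d} {R : realType} {M : moral_hazard Y R}.
Hypothesis HM : maintained M.
Local Notation nu := (dom_meas M).
Local Notation a0 := (act0 M).
Local Notation u := (util M).
Local Notation c := (cost M).
Local Notation w0 := (wealth0 M).
Local Notation s := (score M).
Local Notation m0 := (m0 M).
Local Notation Lext := (Lext M).
Local Notation can := (canonical_contract M).
Local Notation h := (canonical_util (M := M)).
Local Notation intble g := (nu.-integrable [set: Y] (fun y => (g y)%:E)).
Local Notation f1 y := (dens_d M 1 y a0).
Local Notation incentive l m := (agent_incentive M (can l m) a0).

Lemma canonical_integrable j l m a : (0 < j <= 2)%N -> actions M a ->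
  intble (fun y => h (l + m * s y) * dens_d M j y a).
Proof.
move=> j2 Aa; have [_ + _] := contract_diff (canonical_is_contract HM l m) j2 Aa.
by apply: eq_integrable => // y _; rewrite util_canonical.
Qed.

(** Shifting utility by a constant is free because [dens_d] integrates to 0. With [k = h l] and
    [m >= 0] the difference takes the sign of the score, in the weak sense. *)
Lemma canonical_centered j l m a (k : R) : (0 < j <= 2)%N ->
  act_lo M < a < act_hi M ->
  \int[nu]_y (h (l + m * s y) * dens_d M j y a) =
  \int[nu]_y ((h (l + m * s y) - k) * dens_d M j y a).
Proof.
move=> j2 Aa; have A := interior_actions Aa.
under [RHS]eq_Rintegral do rewrite mulrBl.
rewrite RintegralB//; first 1 last.
- exact: canonical_integrable.
- exact: integrable_realZ (dens_d_integrable HM j2 A).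
by rewrite RintegralZl ?dens_d_int0 ?mulr0 ?subr0//; exact: dens_d_integrable.
Qed.

Lemma canonical_centered_integrable j l m a (k : R) : (0 < j <= 2)%N ->
  actions M a -> intble (fun y => (h (l + m * s y) - k) * dens_d M j y a).
Proof.
move=> j2 A; have := integrable_realB (canonical_integrable l m j2 A)
  (integrable_realZ k (dens_d_integrable HM j2 A)).
by apply: eq_integrable => // y _; rewrite mulrBl.
Qed.

Lemma incentiveE l m :
  incentive l m = \int[nu]_y (h (l + m * s y) * f1 y) - cost_d M 1 a0.
Proof.
rewrite (agent_incentiveE HM)//; last exact: (canonical_is_contract HM).
by under eq_Rintegral do rewrite util_canonical.
Qed.

Lemma incentive_mu0 l : incentive l 0 < 0.
Proof.
rewrite incentiveE (@canonical_centered _ _ _ _ (h l))//; last exact: act0_interior.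
under eq_Rintegral do rewrite mul0r addr0 subrr mul0r.
by rewrite Rintegral_cst// mul0r sub0r oppr_lt0 (cost_d1_gt0 HM).
Qed.

Lemma score_gt0 y : (0 < s y) = (0 < f1 y).
Proof. by rewrite -score_mul (pmulr_lgt0 _ (dens0_gt0 y)). Qed.

Lemma score_le0 y : (s y <= 0) = (f1 y <= 0).
Proof. by rewrite -score_mul (pmulr_lle0 _ (dens0_gt0 y)). Qed.

(** Otherwise the integral in [incentive_capacity] would be 0, and so would its product with
    [util_range], even an infinite one, although [c'(a0) > 0]. *)
Lemma score_not_ae_le0 : ~ \forall y \ae nu, s y <= 0.
Proof.
move=> s0; have := incentive_capacity HM.
have mf1 := integrable_measurable (dens_d_integrable HM (isT : (0 < 1 <= 2)%N) act0_in).
rewrite (_ : \int[nu]_(y in _) _ = 0)%E ?mule0.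
  by rewrite lte_fin ltNge ltW// (cost_d1_gt0 HM).
rewrite -[RHS](@integral0 _ _ _ nu [set y | 0 < f1 y]).
have mD : measurable [set y | 0 < f1 y].
  by rewrite -[X in measurable X]setTI; exact: (measurable_fun_ltr (measurable_cst _) mf1 measurableT (Y := [set true])).
apply: ae_eq_integral => //.
- by apply/measurable_EFinP; apply: measurable_funS mf1.
- by apply: filterS s0 => y; rewrite score_le0 => le0 /=; rewrite ltNge le0.
Qed.

(** Raising [m] moves [h] in the direction of the score, so the integrand rises at every [y]. Equal
    integrals would force equality almost everywhere, but at a positive score the index is above
    [m0], where [h] is strictly increasing. *)
Lemma incentive_incr l m m' : m0 <= l -> 0 <= m -> m < m' ->
  incentive l m < incentive l m'.
Proof.
move=> ml m00 mm'; rewrite !incentiveE ltrD2r ltNge; apply/negP => le.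
have i2 : (0 < 1 <= 2)%N by [].
have fg y : h (l + m * s y) * f1 y <= h (l + m' * s y) * f1 y.
  have [sy|sy] := leP (s y) 0.
    rewrite ler_wnM2r -?score_le0//; apply: (canonical_util_mono HM).
    by rewrite lerD2l ler_wnM2r// ltW.
  rewrite ler_wpM2r -?score_gt0//; first by rewrite ltW// -score_gt0.
  by apply: (canonical_util_mono HM); rewrite lerD2l ler_wpM2r// ltW.
have := Rintegral_eq_ae (canonical_integrable l m i2 act0_in)
  (canonical_integrable l m' i2 act0_in) fg le.
move=> ae; apply: score_not_ae_le0; apply: filterS ae => y.
have [//|sy] := leP (s y) 0 => e; exfalso.
have := sy; rewrite score_gt0 => f1y.
have : h (l + m * s y) < h (l + m' * s y).
  apply: (canonical_util_incr HM); last by rewrite ltrD2l ltr_pM2r.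
  by rewrite (le_trans ml)// lerDl mulr_ge0// ltW.
by rewrite -(ltr_pM2r f1y) e ltxx.
Qed.

(** Every score up to [q] is paid the minimum [u w0], which contributes exactly the capacity bound
    after centering at [h l]; all other scores contribute nonnegatively. *)
Lemma incentive_gt0 l m q : 0 <= m -> l + m * q <= m0 ->
  cost_d M 1 a0 < (h l - u w0) * \int[nu]_(y in [set y | s y <= q]) (- f1 y) ->
  0 < incentive l m.
Proof.
move=> m00 lq cl; have i2 : (0 < 1 <= 2)%N by [].
rewrite incentiveE subr_gt0 (@canonical_centered _ _ _ _ (h l))//; last exact: act0_interior.
apply: lt_le_trans cl _.
have f1i := dens_d_integrable HM i2 act0_in.
have mD := measurable_score_le HM q.
have nf1i : nu.-integrable [set y | s y <= q] (fun y => (- f1 y)%:E).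
  apply: (@integrableS _ _ _ nu setT) => //.
  by have := integrable_realZ (-1) f1i; apply: eq_integrable => // y _; rewrite mulN1r.
rewrite -RintegralZl// Rintegral_mkcond; apply: le_Rintegral => //.
- have := integrableZl mD (h l - u w0) nf1i.
  move=> /(integrable_mkcond _ mD); apply: eq_integrable => // y _.
  by rewrite /= /patch; case: (_ \in _).
- by apply: canonical_centered_integrable => //; exact: act0_in.
move=> y _; rewrite /patch; case: ifPn => [/set_mem/= syq|_].
  rewrite (canonical_util_le_m0 HM (x := l + m * s y)); last first.
    by apply: le_trans lq; rewrite lerD2l ler_wpM2l.
  by rewrite mulrN -mulNr opprB.
have [sy|sy] := leP (s y) 0.
  apply: mulr_le0; last by rewrite -score_le0.
  by rewrite subr_le0; apply: (canonical_util_mono HM); rewrite gerDl mulr_ge0_le0.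
apply: mulr_ge0; last by rewrite ltW// -score_gt0.
by rewrite subr_ge0; apply: (canonical_util_mono HM); rewrite lerDl mulr_ge0// ltW.
Qed.

(* On the safe region both the score and h(l + m s) - h(l) are nonpositive while
   f_aa >= 0, so only {s > q} contributes, where h is k-Lipschitz. *)
Lemma utility_curvature_le l m q a k kappa : safe_scores M q ->
  act_lo M < a < act_hi M -> 0 <= m -> 0 <= k ->
  (forall x y, l + m * q <= y -> y <= x -> h x - h y <= k * (x - y)) ->
  (\int[nu]_(y in [set y | (q < s y)%R])
     (Num.max (s y * dens_d M 2 y a) 0)%:E <= kappa%:E)%E ->
  \int[nu]_y (h (l + m * s y) * dens_d M 2 y a) <= k * m * kappa.
Proof.
move=> [q0 safe] Aa m00 k0 lip curv; have i2 : (0 < 2 <= 2)%N by [].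
have A := interior_actions Aa.
rewrite (@canonical_centered _ _ _ _ (h l))//.
pose B y := if q < s y then Num.max (s y * dens_d M 2 y a) 0 else 0.
have mf2 := integrable_measurable (dens_d_integrable HM i2 A).
have ms := score_measurable HM.
have mB : measurable_fun [set: Y] B.
  apply: measurable_fun_ifT => //; first exact: measurable_fun_ltr.
  by apply: measurable_maxr => //; exact: measurable_funM.
have B0 y : 0 <= B y by rewrite /B; case: ifP => // _; rewrite le_max lexx orbT.
have IB : (\int[nu]_y (B y)%:E <= kappa%:E)%E.
  move: curv; rewrite integral_mkcond; congr (_ <= _)%E; apply: eq_integral => y _.
  by rewrite /patch /B; case: ifPn => [/set_mem/= ->//|]; case: ifPn => // qs /negP[]; exact: mem_set.
have Bi : intble B.
  apply/integrableP; split; first exact/measurable_EFinP.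
  under eq_integral do rewrite gee0_abs ?lee_fin//.
  exact: le_lt_trans IB (ltry _).
have RB : \int[nu]_y B y <= kappa.
  by rewrite -lee_fin /Rintegral fineK//; exact: integrable_fin_num.
apply: le_trans (_ : k * m * \int[nu]_y B y <= _); last first.
  by rewrite ler_wpM2l ?mulr_ge0.
rewrite -RintegralZl//; apply: ae_le_Rintegral.
- exact: canonical_centered_integrable.
- exact: integrable_realZ.
apply: filterS (safe a A) => y sy; rewrite /B; case: ltP => qs; last first.
  rewrite mulr0 mulr_le0_ge0 ?sy// subr_le0; apply: (canonical_util_mono HM).
  by rewrite gerDl mulr_ge0_le0// (le_trans qs).
set D := h _ - h l; set g := dens_d M 2 y a; set mx := Num.max _ _.
have mx0 : 0 <= mx by rewrite le_max lexx orbT.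
have mxs : s y * g <= mx by rewrite le_max lexx.
have km0 : 0 <= k * m by rewrite mulr_ge0.
have kmx : 0 <= k * m * mx by rewrite mulr_ge0.
have kms : k * m * (s y * g) <= k * m * mx by rewrite ler_wpM2l.
have lq : l + m * q <= l + m * s y by rewrite lerD2l ler_wpM2l// ltW.
(* In both cases [D] lies between 0 and [k * m * s y], so [D * g] is at most [k * m * mx] whatever
   the sign of [g]. *)
have [sy0|sy0] := leP 0 (s y).
  have Dge : 0 <= D.
    by rewrite subr_ge0; apply: (canonical_util_mono HM); rewrite lerDl mulr_ge0.
  have Dle : D <= k * m * s y.
    rewrite -mulrA; have := lip (l + m * s y) l; rewrite [X in k * X](_ : _ = m * s y); last by lra.
    apply.
      by rewrite gerDl mulr_ge0_le0.
    by rewrite lerDl mulr_ge0.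
  have [g0|g0] := leP 0 g; last by apply: le_trans kmx; rewrite mulr_ge0_le0// ltW.
  by apply: le_trans kms; rewrite mulrA ler_wpM2r.
have Dle : D <= 0.
  by rewrite subr_le0; apply: (canonical_util_mono HM); rewrite gerDl mulr_ge0_le0// ltW.
have Dge : k * m * s y <= D.
  have : l + m * s y <= l by rewrite gerDl mulr_ge0_le0// ltW.
  move=> /(lip _ _ lq); rewrite [X in k * X](_ : _ = - (m * s y)); last by lra.
  by rewrite /D -mulrA mulrN; lra.
have [g0|g0] := leP 0 g; first by apply: le_trans kmx; rewrite mulr_le0_ge0.
by apply: le_trans kms; rewrite mulrA ler_wnM2r// ltW.
Qed.

Lemma gross_utility_derivable w a : Defs.contract M w -> actions M a ->
  derivable_in (actions M) (gross_utility M w) a.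
Proof. by move=> cw A; have [] := contract_diff cw (isT : (0 < 1 <= 2)%N) A. Qed.

Lemma cost_derivable a : actions M a -> derivable_in (actions M) c a.
Proof. by move=> A; apply: ((cost_C2 HM).1 0%N). Qed.

Lemma agent_utility_derivable w a : Defs.contract M w -> actions M a ->
  derivable_in (actions M) (agent_utility M w) a.
Proof.
move=> cw A; apply: derivable_inB; first exact: gross_utility_derivable.
exact: cost_derivable.
Qed.

Lemma actions_sub x y : actions M x -> actions M y -> `[x, y] `<=` actions M.
Proof.
move=> /actionsP/andP[lx _] /actionsP/andP[_ yh] z /=.
rewrite in_itv/= => /andP[xz zy].
by apply/actionsP/andP; split; [exact: le_trans xz|exact: le_trans yh].
Qed.

Lemma interior_sub x y z : actions M x -> actions M y -> z \in `]x, y[ ->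
  act_lo M < z < act_hi M.
Proof.
move=> /actionsP/andP[lx _] /actionsP/andP[_ yh]; rewrite in_itv/= => /andP[xz zy].
by rewrite (le_lt_trans lx xz) (lt_le_trans zy yh).
Qed.

(** Two applications of the mean value theorem: one writes the utility gap as [U' z] times the
    distance to [a0], the other derives the sign of [U' z] from [U' a0 = 0] and [U'' <= 0]. All
    intermediate points are interior actions. *)
Lemma concave_utility_global_max w : Defs.contract M w ->
  agent_incentive M w a0 = 0 ->
  (forall a, act_lo M < a < act_hi M ->
     \int[nu]_y (u (w0 + w y) * dens_d M 2 y a) <= cost_d M 2 a) ->
  forall a, actions M a -> agent_utility M w a <= agent_utility M w a0.
Proof.
move=> cw foc soc a A; have A0 := act0_in (M := M).
(* This difference is derivable on all of [D]; it is identified with the derivative of the agent's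
   utility in the interior only. *)
pose D := actions M; pose U' x := deriv_in D (gross_utility M w) x - deriv_in D c x.
have U'E x : act_lo M < x < act_hi M -> deriv_in D (agent_utility M w) x = U' x.
  move=> Ax; have B := interior_actions Ax.
  rewrite /agent_utility deriv_inB//; first exact: interior_nbhs.
    exact: gross_utility_derivable.
  exact: cost_derivable.
have dgross x : actions M x -> derivable_in D (deriv_in D (gross_utility M w)) x.
  by move=> Ax; have [] := contract_diff cw (isT : (0 < 2 <= 2)%N) Ax.
have dcost x : actions M x -> derivable_in D (deriv_in D c) x.
  by move=> Ax; apply: ((cost_C2 HM).1 1%N).
have dU' x : actions M x -> derivable_in D U' x.
  by move=> Ax; apply: derivable_inB; [exact: dgross|exact: dcost].
have U''le x : act_lo M < x < act_hi M -> deriv_in D U' x <= 0.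
  move=> Ax; have B := interior_actions Ax.
  rewrite deriv_inB//; [|exact: interior_nbhs|exact: dgross|exact: dcost].
  have [_ _ e] := contract_diff cw (isT : (0 < 2 <= 2)%N) B.
  by have := soc x Ax; rewrite -e subr_le0.
have U'0 : U' a0 = 0 by rewrite -U'E//; exact: act0_interior.
have dU x : actions M x -> derivable_in D (agent_utility M w) x.
  exact: agent_utility_derivable.
have [aa0|a0a|->//] := ltgtP a a0.
- have [z zi e] := MVT_in dU (actions_sub A A0) aa0.
  have Az := interior_sub A A0 zi; move: (zi); rewrite in_itv/= => /andP[_ za0].
  have [t ti e'] := MVT_in dU' (actions_sub (interior_actions Az) A0) za0.
  have At := interior_sub (interior_actions Az) A0 ti.
  have : U' a0 - U' z <= 0 by rewrite e' mulr_le0_ge0 ?U''le// subr_ge0 ltW.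
  rewrite U'0 sub0r oppr_le0 => U'z; rewrite -subr_ge0 e U'E//.
  by apply: mulr_ge0 => //; rewrite subr_ge0 ltW.
- have [z zi e] := MVT_in dU (actions_sub A0 A) a0a.
  have Az := interior_sub A0 A zi; move: (zi); rewrite in_itv/= => /andP[a0z _].
  have [t ti e'] := MVT_in dU' (actions_sub A0 (interior_actions Az)) a0z.
  have At := interior_sub A0 (interior_actions Az) ti.
  have : U' z - U' a0 <= 0 by rewrite e' mulr_le0_ge0 ?U''le// subr_ge0 ltW.
  rewrite U'0 subr0 => U'z; rewrite -subr_le0 e U'E//.
  by apply: mulr_le0_ge0 => //; rewrite subr_ge0 ltW.
Qed.

(** The intended action is an interior maximum, so its derivative vanishes. Hence a relaxed solution
    that is globally incentive compatible is optimal in the smaller feasible set. *)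
Lemma cmp_relaxed_feasible Ubar w : cmp_feasible M Ubar w -> relaxed_feasible M Ubar w.
Proof.
move=> [cw Uw IC]; split => //.
have dU a : act_lo M < a < act_hi M ->
    is_derive a 1 (agent_utility M w) (deriv_in (actions M) (agent_utility M w) a).
  move=> Aa; apply: derivable_in_interior; first exact: interior_nbhs.
  by apply: agent_utility_derivable => //; exact: interior_actions.
have lh : act_lo M <= act_hi M.
  by have /andP[l r] := act0_interior M; rewrite ltW// (lt_trans l).
have H0 : is_derive a0 1 (agent_utility M w) 0.
  apply: (derive1_at_max lh).
  - by move=> t; rewrite in_itv => /dU[].
  - by rewrite in_itv; exact: act0_interior.
  - by move=> t; rewrite in_itv => At; apply: IC; exact: interior_actions.
rewrite /agent_incentive.
by rewrite -(@derive_val _ _ _ _ _ _ _ (dU a0 (act0_interior M))) derive_val.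
Qed.

End Incentives.

(** * The path of binding canonical contracts *)

Section LagrangianArithmetic.
Context {R : realType}.
Implicit Types l v x p : R.

Lemma lagrangian_gap l l' v v' x x' : x - l * v <= x' - l * v' ->
  x' - l' * v' <= x - l' * v -> 0 <= (l' - l) * (v' - v).
Proof. by lra. Qed.

Lemma lagrangian_cost_le x x' p p' : x - p <= x' - p' -> p <= p' -> x <= x'.
Proof. by lra. Qed.

Lemma lagrangian_utility_ge l v v' v'' x x' : 0 <= x ->
  x' <= (v' - v'') * l -> x - l * v <= x' - l * v' -> l * v'' <= l * v.
Proof. by lra. Qed.

Lemma lagrangian_swap l l' v v' x x' : v' = v ->
  x' - l' * v' <= x - l' * v -> x' - l * v' <= x - l * v.
Proof. by move=> ->; rewrite !lerD2r. Qed.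

Lemma min_max_bounds v v' x : v <= x -> x <= v' ->
  Num.min v v' <= x <= Num.max v v'.
Proof. by move=> h1 h2; rewrite ge_min h1 le_max h2 orbT. Qed.

Lemma le_not_lt_eq v v' : v <= v' -> ~ v < v' -> v' = v.
Proof. by rewrite le_eqVlt => /predU1P[]. Qed.

End LagrangianArithmetic.

Definition foa_near_sup d (Y : measurableType d) (R : realType)
    (M : moral_hazard Y R) : Prop :=
  exists Ustar : R, (Ustar%:E < relaxed_sup M)%E /\
    forall Ubar : R, Ustar <= Ubar -> (Ubar%:E < relaxed_sup M)%E ->
      foa_valid M Ubar /\
      exists (w : Y -> R) (lambda mu : R),
        [/\ relaxed_solution M Ubar w,
            forall v, relaxed_solution M Ubar v ->
              \forall y \ae dom_meas M, v y = w y,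
            0 <= lambda &
            \forall y \ae dom_meas M, w y = canonical_contract M lambda mu y].

Section Threshold.
Context {d} {Y : measurableType d} {R : realType} {M : moral_hazard Y R}.
Hypothesis HM : maintained M.
Local Notation nu := (dom_meas M).
Local Notation a0 := (act0 M).
Local Notation u := (util M).
Local Notation w0 := (wealth0 M).
Local Notation s := (score M).
Local Notation m0 := (m0 M).
Local Notation Lext := (Lext M).
Local Notation can := (canonical_contract M).
Local Notation h := (canonical_util (M := M)).
Local Notation incentive l m := (agent_incentive M (can l m) a0).

(** Data common to both alternatives: [q'] and [W] secure enough incentives, [q] and [kappa] bound
    the curvature, [K] and [z0] come from the tail of risk aversion. Alternative (i) takes [K]
    small; log utility has [K = 1] and takes [q - q'] large instead. *)
Variables q' q K kappa z0 W : R.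
Hypotheses (q'q : q' < q) (safeq : safe_scores M q) (K0 : 0 <= K)
  (kappa0 : 0 <= kappa) (wW : w0 <= W).
Hypothesis capacity : cost_d M 1 a0 <
  (u W - u w0) * \int[nu]_(y in [set y | s y <= q']) (- dens_d M 1 y a0).
Hypothesis curvature : forall a, actions M a ->
  (\int[nu]_(y in [set y | (q < s y)%R])
     (Num.max (s y * dens_d M 2 y a) 0)%:E <= kappa%:E)%E.
Hypothesis lipschitz : forall z x y, z0 <= z -> z <= y -> y <= x ->
  h x - h y <= K / z * (x - y).
Hypothesis cost_convexity : forall a, actions M a ->
  K * kappa / (q - q') <= cost_d M 2 a.

(** The first term keeps [l] above the truncation point, the second gives [h l >= u W], and the
    third pushes the index at score [q] beyond [z0]. *)
Definition lambda_min :=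
  Num.max (m0 + 1) (Num.max (util_d M 1 W)^-1 (z0 * - q' / (q - q'))).

Lemma q'_lt0 : q' < 0.
Proof. by case: safeq => q0 _; exact: lt_le_trans q'q q0. Qed.

Lemma lambda_min_gt_m0 l : lambda_min <= l -> m0 < l.
Proof.
by move=> hl; rewrite (lt_le_trans _ hl)// lt_max ltrDl ltr01.
Qed.

Lemma lambda_gt0 l : lambda_min <= l -> 0 < l.
Proof. by move=> /lambda_min_gt_m0; apply: lt_trans; exact: m0_gt0. Qed.

Lemma capacity_canonical l : lambda_min <= l -> cost_d M 1 a0 <
  (h l - u w0) * \int[nu]_(y in [set y | s y <= q']) (- dens_d M 1 y a0).
Proof.
move=> hl; apply: lt_le_trans capacity _; rewrite ler_wpM2r//.
  apply: Rintegral_ge0 => y /= sy; rewrite oppr_ge0 -score_le0.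
  by rewrite (le_trans sy)// ltW// q'_lt0.
rewrite lerD2r -{1}(Lext_util_d1 HM wW); apply: (canonical_util_mono HM).
by rewrite (le_trans _ hl)// /lambda_min !le_max lexx !orbT.
Qed.

Lemma incentive_cvg l m : incentive l' m @[l' --> l] --> incentive l m.
Proof.
have : continuous (fun p : R * R => incentive p.1 p.2).
  exact: canonical_incentive_continuous HM.
move=> /(_ (l, m)) cg.
exact: (@continuous2_cvg _ _ _ _ (nbhs l) _ id (cst m)
  (fun l m => incentive l m) l m cg cvg_id (cvg_cst m)).
Qed.

Lemma incentive_mu_continuous l : continuous (fun m => incentive l m).
Proof.
move=> m; have : continuous (fun p : R * R => incentive p.1 p.2).
  exact: canonical_incentive_continuous HM.
move=> /(_ (l, m)) cg.
exact: (@continuous2_cvg _ _ _ _ (nbhs m) _ (cst l) id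
  (fun l m => incentive l m) l m cg (cvg_cst l) cvg_id).
Qed.

Lemma mu_exists l : lambda_min <= l -> exists m, 0 <= m /\ incentive l m = 0.
Proof.
(* At [m1] the index at score [q'] is exactly [m0], so [incentive_gt0] applies; at 0 the incentive
   is negative. *)
move=> hl; pose m1 := (m0 - l) / q'.
have m10 : 0 <= m1.
  rewrite mulr_le0// ?subr_le0 ?invr_le0 ltW ?q'_lt0//.
  exact: lambda_min_gt_m0.
have e : l + m1 * q' = m0 by rewrite /m1 divfK ?lt_eqF ?q'_lt0// addrC subrK.
have m1_gt0 : 0 < incentive l m1.
  by apply: (incentive_gt0 HM (q := q')) => //; [rewrite e|exact: capacity_canonical].
have [||m + im] := @IVT R (fun m => incentive l m) 0 m1 0 m10.
- exact/continuous_subspaceT/incentive_mu_continuous.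
- apply/andP; split; first by rewrite ge_min; apply/orP; left; apply/ltW/incentive_mu0.
  by rewrite le_max; apply/orP; right; exact: ltW.
by rewrite in_itv/= => /andP[m00 _]; exists m.
Qed.

Definition binding_mu l := get [set m | 0 <= m /\ incentive l m = 0].
Local Notation mu := binding_mu.

Lemma binding_muP l : lambda_min <= l -> 0 < mu l /\ incentive l (mu l) = 0.
Proof.
move=> hl; have [m00 i0] : 0 <= mu l /\ incentive l (mu l) = 0.
  exact: (@getPex _ [set m | 0 <= m /\ incentive l m = 0] (mu_exists hl)).
split => //; rewrite lt_neqAle m00 andbT; apply/eqP => e.
by have := incentive_mu0 HM l; rewrite -e in i0; rewrite i0 ltxx.
Qed.

(** Otherwise all scores up to [q'] would be paid the minimum, and the incentive would be positive
    instead of 0. *)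
Lemma binding_mu_score l : lambda_min <= l -> m0 < l + mu l * q'.
Proof.
move=> hl; have [m00 i0] := binding_muP hl; rewrite ltNge; apply/negP => le.
have pos := incentive_gt0 HM (ltW m00) le (capacity_canonical hl).
by rewrite i0 ltxx in pos.
Qed.

(** The incentive is positive at [mu l + e] and negative just below [mu l]. Both signs persist for
    [l'] near [l], and monotonicity in the multiplier traps [mu l'] in between. *)
Lemma binding_mu_continuous (l : R) : lambda_min < l -> {for l, continuous mu}.
Proof.
move=> hl; have [m00 i0] := binding_muP (ltW hl).
have ml := ltW (lambda_min_gt_m0 (ltW hl)).
have nl : \forall l' \near l, lambda_min <= l'.
  by apply: filterS (lt_nbhsr hl) => l'; exact: ltW.
apply/cvgrPdist_lt => e e0.
have up : \forall l' \near l, 0 < incentive l' (mu l + e).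
  have /cvgr_gt := @incentive_cvg l (mu l + e); apply.
  by rewrite -i0; apply: incentive_incr => //; [exact: ltW|rewrite ltrDl].
(* Truncated at 0 because [incentive_incr] starts from a nonnegative multiplier; [mu l > 0] keeps
   [m < mu l]. *)
pose m := Num.max 0 (mu l - e).
have mge0 : 0 <= m by rewrite le_max lexx.
have dn : \forall l' \near l, incentive l' m < 0.
  have /cvgr_lt := @incentive_cvg l m; apply.
  rewrite -i0; apply: incentive_incr => //.
  by rewrite gt_max m00/= gtrBl.
near=> l'; have hl' : lambda_min <= l' by near: l'.
have ml' := ltW (lambda_min_gt_m0 hl').
have [m0' i0'] := binding_muP hl'.
have up' : 0 < incentive l' (mu l + e) by near: l'.
have dn' : incentive l' m < 0 by near: l'.
rewrite distrC ltr_distl; apply/andP; split.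
  apply: (@le_lt_trans _ _ m); first by rewrite le_max lexx orbT.
  rewrite ltNge; apply/negP; rewrite le_eqVlt => /predU1P[em|lt].
    by rewrite -em i0' ltxx in dn'.
  have := lt_trans (incentive_incr HM ml' (ltW m0') lt) dn'.
  by rewrite i0' ltxx.
rewrite ltNge; apply/negP; rewrite le_eqVlt => /predU1P[em|lt].
  by rewrite em i0' ltxx in up'.
have := lt_trans up' (incentive_incr HM ml' (addr_ge0 (ltW m00) (ltW e0)) lt).
by rewrite i0' ltxx.
Unshelve. all: by end_near. Qed.

Lemma agent_utility_ae v v' a : Defs.contract M v -> Defs.contract M v' ->
  actions M a -> (\forall y \ae nu, v y = v' y) ->
  agent_utility M v a = agent_utility M v' a.
Proof.
move=> cv cv' A e; congr (_ - _); apply: ae_eq_Rintegral.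
- exact: integrable_measurable (contract_utility cv A).
- exact: integrable_measurable (contract_utility cv' A).
- by apply: filterS e => y ->.
Qed.

Lemma expected_wage_ge0 v : Defs.contract M v -> 0 <= expected_wage M v a0.
Proof.
move=> cv; apply: Rintegral_ge0 => y _; rewrite mulr_ge0 ?(contract_ge0 cv)//.
by rewrite ltW ?dens0_gt0.
Qed.

Lemma canonical_wealth l m y : w0 + can l m y = Lext (l + m * s y).
Proof. by rewrite /canonical_contract addrC subrK. Qed.

#[local] Opaque agent_utility expected_wage agent_incentive canonical_contract
  binding_mu.

Local Notation w l := (can l (mu l)).
Local Notation V l := (agent_utility M (w l) a0).
Local Notation C l := (expected_wage M (w l) a0).

Lemma utility_path_continuous l : lambda_min < l ->
  {for l, continuous (fun l => V l)}.
Proof.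
move=> hl; have : continuous (fun p : R * R => agent_utility M (can p.1 p.2) a0).
  exact: canonical_utility_continuous HM.
move=> /(_ (l, mu l)) cg.
exact: (@continuous2_cvg _ _ _ _ (nbhs l) _ id mu
  (fun l m => agent_utility M (can l m) a0) l (mu l) cg cvg_id
  (binding_mu_continuous hl)).
Qed.

Lemma path_contract l : Defs.contract M (w l).
Proof. exact: canonical_is_contract. Qed.

Lemma path_optimal l v : lambda_min <= l -> Defs.contract M v ->
  agent_incentive M v a0 = 0 ->
  C l - l * V l <= expected_wage M v a0 - l * agent_utility M v a0 /\
  (expected_wage M v a0 - l * agent_utility M v a0 <= C l - l * V l ->
   \forall y \ae nu, v y = w l y).
Proof.
move=> hl cv iv; have [_ i0] := binding_muP hl.
have := lagrangian_min HM l (mu l) cv.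
by rewrite /lagrangian iv i0 !mulr0 !subr0.
Qed.

Lemma path_global_IC l : lambda_min <= l -> forall a, actions M a ->
  agent_utility M (w l) a <= V l.
Proof.
move=> hl; have [m00 i0] := binding_muP hl.
apply: (concave_utility_global_max HM (path_contract l) i0) => a Aa.
under eq_Rintegral do rewrite util_canonical.
have A := interior_actions Aa; have mq' := lt_trans (m0_gt0 HM) (binding_mu_score hl).
have [q0 _] := safeq; have qq0 : 0 < q - q' by rewrite subr_gt0.
set z := l + mu l * q.
have zmu : mu l * (q - q') <= z by rewrite /z; lra.
have zgt0 : 0 < z by apply: lt_le_trans zmu; exact: mulr_gt0.
(* From [q <= 0] and [l + mu l * q' > 0] one gets [z * - q' >= l * (q - q')], and the third term of
   [lambda_min] concludes. *)
have zz0 : z0 <= z.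
  have hz : z0 * - q' / (q - q') <= l.
    by rewrite (le_trans _ hl)// /lambda_min !le_max lexx !orbT.
  rewrite ler_pdivrMr// in hz.
  have q'0 : 0 < - q' by rewrite oppr_gt0 q'_lt0.
  rewrite -(ler_pM2r q'0); apply: le_trans hz _; rewrite -subr_ge0.
  have -> : z * - q' - l * (q - q') = - q * (l + mu l * q') by rewrite /z; lra.
  by rewrite mulr_ge0 ?oppr_ge0// ltW.
apply: le_trans (cost_convexity A).
have := utility_curvature_le HM safeq Aa (ltW m00) (divr_ge0 K0 (ltW zgt0))
  (fun x y zy yx => lipschitz zz0 zy yx) (curvature A).
move/le_trans; apply.
have -> : K / z * mu l * kappa = K * kappa * (mu l / z) by lra.
rewrite ler_wpM2l ?mulr_ge0// ler_pdivrMr// mulrC ler_pdivlMr//.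
Qed.

Lemma path_mono l l' : lambda_min <= l -> l < l' -> V l <= V l'.
Proof.
move=> hl ll'; have hl' := le_trans hl (ltW ll').
have [h1 _] := path_optimal hl (path_contract l') (binding_muP hl').2.
have [h2 _] := path_optimal hl' (path_contract l) (binding_muP hl).2.
have := lagrangian_gap h1 h2.
rewrite pmulr_rge0; last by rewrite subr_gt0.
by rewrite subr_ge0.
Qed.

(** If [V] stayed at [V l], each later contract on the path would also minimise the Lagrangian at
    [l] and so coincide with [w l] almost everywhere. At a positive score, however, wages grow
    without bound in the multiplier. Integer steps keep the exceptional null sets countable. *)
Lemma path_not_stationary l : lambda_min <= l -> exists2 l', lambda_min <= l' & V l < V l'.
Proof.
move=> hl; apply: contrapT => no.
have stat n : \forall y \ae nu, w (l + n.+1%:R) y = w l y.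
  have ll' : l < l + n.+1%:R by rewrite ltrDl.
  have hl' := le_trans hl (ltW ll').
  have e : V (l + n.+1%:R) = V l.
    apply: (le_not_lt_eq (path_mono hl ll')) => lt.
    by apply: no; exists (l + n.+1%:R).
  have [_] := path_optimal hl (path_contract _) (binding_muP hl').2; apply.
  have [h2 _] := path_optimal hl' (path_contract l) (binding_muP hl).2.
  exact: lagrangian_swap e h2.
apply: (score_not_ae_le0 HM).
apply: filterS (ae_foralln stat) => y wy; rewrite leNgt; apply/negP => sy.
set X := w0 + w l y.
have wX : w0 <= X + 1.
  by rewrite /X -addrA lerDl addr_ge0// (contract_ge0 (path_contract l)).
(* Large enough that the index at this [y] exceeds [1 / u'(X + 1)], which would give wealth at least
   [X + 1] where it equals [X]. *)
pose n := Num.bound (util_d M 1 (X + 1))^-1.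
have : X + 1 <= X; last by rewrite gerDl ler10.
rewrite -{1}(Lext_util_d1 HM wX) {2}/X -(wy n) canonical_wealth.
apply: (Lext_mono HM).
have hn : (util_d M 1 (X + 1))^-1 <= n.+1%:R.
  have u'0 : 0 <= (util_d M 1 (X + 1))^-1.
    by rewrite invr_ge0 ltW// (util_d1_gt0 HM)// wealthsE.
  by apply: le_trans (ltW (archi_boundP u'0)) _; rewrite ler_nat.
have hl' : lambda_min <= l + n.+1%:R by rewrite (le_trans hl)// lerDl.
have ms0 := mulr_ge0 (ltW (binding_muP hl').1) (ltW sy).
apply: le_trans hn (@le_trans _ _ (l + n.+1%:R) _ _ _ _).
  by rewrite lerDr; exact/ltW/lambda_gt0.
by rewrite lerDl; exact: ms0.
Qed.

(** As [l > 0], a competitor with utility at least [V l] cannot cost less without beating the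
    Lagrangian minimum; one that costs the same attains this minimum and is therefore equal almost
    everywhere. *)
Lemma relaxed_solution_path l : lambda_min <= l ->
  relaxed_solution M (V l) (w l) /\
  forall v, relaxed_solution M (V l) v -> \forall y \ae nu, v y = w l y.
Proof.
move=> hl; have [_ i0] := binding_muP hl; have l0 := lambda_gt0 hl.
have feas : relaxed_feasible M (V l) (w l) by split => //; exact: path_contract.
split=> [|v [[cv Uv iv] vmin]].
  split => // v [cv Uv iv].
  have [h1 _] := path_optimal hl cv iv.
  by apply: lagrangian_cost_le h1 _; rewrite ler_pM2l.
have [_] := path_optimal hl cv iv; apply.
apply: lerB; first exact: vmin.
by rewrite ler_pM2l.
Qed.

Lemma foa_valid_path l : lambda_min <= l -> foa_valid M (V l).
Proof.
move=> hl v vsol; have [_ uniq] := relaxed_solution_path hl.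
have vw := uniq v vsol; have [[cv Uv iv] vmin] := vsol.
split; last by move=> v' /(cmp_relaxed_feasible HM); exact: vmin.
split => // a A; rewrite !(agent_utility_ae cv (path_contract l) _ vw)//.
  exact: path_global_IC.
exact: act0_in.
Qed.

Lemma foa_below_relaxed_sup : foa_near_sup M.
Proof.
(* Continuity of [V] is established strictly above [lambda_min], whence the shift. *)
pose l1 := lambda_min + 1.
have ll1 : lambda_min < l1 by rewrite ltrDl.
exists (V l1); split.
  have [l2 hl2 lt] := path_not_stationary (ltW ll1).
  apply: (@lt_le_trans _ _ (V l2)%:E); first by rewrite lte_fin.
  apply: ereal_sup_ubound; exists (V l2); last by [].
  exists (w l2); exact: (relaxed_solution_path hl2).1.1.
move=> Ubar hU /ereal_sup_gt[_ [U' [v [cv Uv iv]] <-]]; rewrite lte_fin => UU'.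
have dU : 0 < agent_utility M v a0 - Ubar by rewrite subr_gt0 (lt_le_trans UU').
(* The Lagrangian inequality gives [V l2 >= U(v) - C(v) / l2], and this choice makes the right side
   at least [Ubar]. The intermediate value theorem then applies between [l1] and [l2]. *)
pose l2 := Num.max l1 (expected_wage M v a0 / (agent_utility M v a0 - Ubar)).
have l12 : l1 <= l2 by rewrite le_max lexx.
have hl2 : lambda_min <= l2 by rewrite (le_trans (ltW ll1)).
have V2 : Ubar <= V l2.
  have [hC _] := path_optimal hl2 cv iv.
  have C0 : 0 <= C l2 by apply: expected_wage_ge0; exact: path_contract.
  have : expected_wage M v a0 / (agent_utility M v a0 - Ubar) <= l2.
    by rewrite le_max lexx orbT.
  rewrite ler_pdivrMr// mulrC => Cv.
  rewrite -(ler_pM2l (lambda_gt0 hl2)).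
  by apply: lagrangian_utility_ge C0 Cv hC.
have [||l + Vl] := @IVT R (fun l => V l) l1 l2 Ubar l12.
- apply: continuous_in_subspaceT => l; rewrite inE/= in_itv/= => /andP[l1l _].
  by apply: utility_path_continuous; exact: lt_le_trans l1l.
- exact: min_max_bounds hU V2.
rewrite in_itv/= => /andP[l1l _].
have hl : lambda_min <= l by rewrite (le_trans (ltW ll1)).
rewrite -Vl; split; first exact: foa_valid_path.
have [sol uniq] := relaxed_solution_path hl.
exists (w l), l, (mu l); split => //; first exact: ltW (lambda_gt0 hl).
exact: nearW.
Qed.

End Threshold.

(** * Capacity and curvature *)

Section Conditions.
Context {d} {Y : measurableType d} {R : realType} {M : moral_hazard Y R}.
Hypothesis HM : maintained M.
Local Notation nu := (dom_meas M).
Local Notation a0 := (act0 M).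
Local Notation u := (util M).
Local Notation w0 := (wealth0 M).
Local Notation s := (score M).
Local Notation m0 := (m0 M).
Local Notation Lext := (Lext M).
Local Notation h := (canonical_util (M := M)).
Local Notation f1 y := (dens_d M 1 y a0).
Local Notation u' := (util_d M 1).
Local Notation curv q a := (\int[nu]_(y in [set y | (q < s y)%R])
     (Num.max (s y * dens_d M 2 y a) 0)%:E)%E.
Local Notation cap q := (\int[nu]_(y in [set y | s y <= q]) (- f1 y)).

Lemma cost_curv_le x a : (x%:E <= cost_curv M)%E -> actions M a -> x <= cost_d M 2 a.
Proof.
move=> xc Aa; rewrite -lee_fin; apply: le_trans xc _.
by apply: ereal_inf_lbound; exists a.
Qed.

Lemma cost_curv_fin x : (x%:E < cost_curv M)%E -> exists2 k, x < k & cost_curv M = k%:E.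
Proof.
move=> xc; have : (cost_curv M <= (cost_d M 2 a0)%:E)%E.
  by apply: ereal_inf_lbound; exists a0 => //; exact: act0_in.
by case: (cost_curv M) xc => // k; rewrite lte_fin => xk _; exists k.
Qed.

Lemma curv_ge0 q a : (0 <= curv q a)%E.
Proof. by apply: integral_ge0 => y _; rewrite lee_fin le_max lexx orbT. Qed.

Lemma Curv_safe_ge0 : (0 <= Curv_safe M)%E.
Proof.
apply: le_ereal_inf_tmp => _ [q _ <-]; apply: le_trans (curv_ge0 q a0) _.
by apply: ereal_sup_ubound; exists a0 => //; exact: act0_in.
Qed.

Lemma Curv_safe_lt kappa : (Curv_safe M < kappa%:E)%E ->
  exists2 q, safe_scores M q & forall a, actions M a -> (curv q a <= kappa%:E)%E.
Proof.
move=> /ereal_inf_lt[_ [q safe <-]] lt; exists q => // a Aa.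
by apply: le_trans (ltW lt); apply: ereal_sup_ubound; exists a.
Qed.

Lemma curv_mono q1 q2 a : q1 <= q2 -> actions M a -> (curv q2 a <= curv q1 a)%E.
Proof.
move=> q12 Aa; apply: ge0_subset_integral; [exact: measurable_score_gt|
  exact: measurable_score_gt| | |].
- apply/measurable_EFinP; apply: measurable_funTS; apply: measurable_maxr => //.
  apply: measurable_funM; first exact: score_measurable.
  exact: integrable_measurable (dens_d_integrable HM (isT : (0 < 2 <= 2)%N) Aa).
- by move=> y _; rewrite lee_fin le_max lexx orbT.
- by move=> y /=; exact: le_lt_trans.
Qed.

Lemma safe_max q1 q2 : safe_scores M q1 -> safe_scores M q2 ->
  safe_scores M (Num.max q1 q2).
Proof. by case: leP. Qed.

Lemma util_derive W : w0 < W -> is_derive W 1 u (u' W).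
Proof.
move=> wW; apply: derivable_in_interior.
  apply: filterS (lt_nbhsr wW) => t wt; rewrite wealthsE; exact: ltW.
by apply: (util_derivable HM); rewrite wealthsE ltW.
Qed.

Lemma util_d1_derive W : w0 < W -> is_derive W 1 u' (util_d M 2 W).
Proof.
move=> wW; apply: derivable_in_interior.
  apply: filterS (lt_nbhsr wW) => t wt; rewrite wealthsE; exact: ltW.
by apply: (util_d1_derivable HM); rewrite wealthsE ltW.
Qed.

(* In units of z = 1/u', the slope of h at z is (u'/A) / z; so A/u' >= 1/K makes
   W |-> (K/z)/u'(W) - u(W) nondecreasing once u'(W) <= 1/z. *)
Lemma canonical_util_lipschitz K W0 : 0 < K -> w0 <= W0 ->
  (forall W, W0 < W -> K^-1 <= risk_aversion M W / u' W) ->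
  exists z0, forall z x y, z0 <= z -> z <= y -> y <= x ->
    h x - h y <= K / z * (x - y).
Proof.
(* The first term avoids the truncation; the second ensures [Lext z >= W0], so that [HA] holds on
   the whole range of wealth considered. *)
move=> K0 wW0 HA; exists (Num.max (m0 + 1) (u' W0)^-1) => z x y z0z zy yx.
have m0z : m0 < z by rewrite (lt_le_trans _ z0z)// lt_max ltrDl ltr01.
have zgt0 : 0 < z := lt_trans (m0_gt0 HM) m0z.
have [my mx] : m0 < y /\ m0 < x.
  by have my := lt_le_trans m0z zy; split => //; exact: lt_le_trans yx.
move: yx; rewrite le_eqVlt => /predU1P[->|yx].
  by rewrite !subrr mulr0.
have LW0 : W0 <= Lext z.
  rewrite -(Lext_util_d1 HM wW0); apply: (Lext_mono HM).
  by rewrite (le_trans _ z0z)// le_max lexx orbT.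
have Lzy := Lext_mono HM zy; have Lyx := Lext_incr HM (ltW my) yx.
have u'L t : m0 < t -> u' (Lext t) = t^-1.
  by move=> mt; rewrite (Lext_spec HM t).2 max_l// ltW.
have w0y : w0 < Lext y.
  by rewrite -(Lext_le_m0 HM (lexx m0)) Lext_incr.
pose phi W := K / z * (u' W)^-1 - u W.
pose dphi W := K / z * (- (u' W) ^- 2 * util_d M 2 W) - u' W.
have u'0 W : w0 < W -> 0 < u' W.
  by move=> wW; rewrite (util_d1_gt0 HM)// wealthsE ltW.
have dphiP W : w0 < W -> is_derive W 1 phi (dphi W).
  move=> wW; rewrite /phi /dphi.
  have du := util_derive wW.
  have dv := is_deriveV (lt0r_neq0 (u'0 W wW)) (util_d1_derive wW).
  have := is_deriveB (is_deriveZ (K / z) dv) du.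
  by [].
have phi_cts : {within `[Lext y, Lext x], continuous phi}.
  apply: derivable_within_continuous => W; rewrite in_itv/= => /andP[yW _].
  by have [] := dphiP W (lt_le_trans w0y yW).
have dphi_in W : W \in `]Lext y, Lext x[ -> is_derive W 1 phi (dphi W).
  by rewrite in_itv/= => /andP[yW _]; exact/dphiP/(lt_trans w0y).
have [W + e] := MVT Lyx dphi_in phi_cts.
rewrite in_itv/= => /andP[yW _].
have wW : w0 < W := lt_trans w0y yW.
have dphi0 : 0 <= dphi W.
  have zW : u' W <= z^-1.
    have := util_d1_decr HM (Lext_ge HM z) (le_lt_trans Lzy yW).
    by rewrite u'L// => /ltW.
  have W0W : W0 < W by rewrite (le_lt_trans LW0)// (le_lt_trans Lzy).
  have := HA W W0W; rewrite /risk_aversion -div1r ler_pdivrMr// => HAW.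
  rewrite /dphi subr_ge0; apply: le_trans zW _.
  rewrite -[leLHS]mul1r [K / z]mulrC -mulrA mulrC ler_pM2l ?invr_gt0//.
  rewrite (le_trans HAW)// le_eqVlt; apply/orP; left; apply/eqP.
  have := lt0r_neq0 (u'0 W wW); move: (u' W) (util_d M 2 W) => p r p0.
  by field.
have : 0 <= phi (Lext x) - phi (Lext y).
  by rewrite e mulr_ge0// subr_ge0 ltW.
rewrite /phi !u'L// !invrK /canonical_util.
set c := K / z; lra.
Qed.

Lemma util_range_le T : (forall W, w0 <= W -> u W <= T) ->
  (util_range M <= (T - u w0)%:E)%E.
Proof.
move=> uT; rewrite /util_range EFinB leeB//.
(* Values of [u] below [w0] are arbitrary; [v] is monotone on the whole line, so its limit exists,
   and it agrees with [u] near infinity. *)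
pose v W := (u (Num.max W w0))%:E.
have vu : \forall W \near +oo, v W = (u W)%:E.
  near=> W; rewrite /v max_l//; near: W; apply: nbhs_pinfty_ge; exact: num_real.
have cv : cvg (v W @[W --> +oo]).
  apply: nondecreasing_is_cvge => x y xy; rewrite lee_fin.
  apply: (util_mono HM); first by rewrite le_max lexx orbT.
  by rewrite ge_max !le_max xy lexx orbT.
have -> : lim ((u W)%:E @[W --> +oo]) = lim (v W @[W --> +oo]).
  by congr (lim _); apply/seteqP; split; apply: near_eq_cvg;
    apply: filterS vu => W ->.
apply: lime_le => //; near=> W.
by rewrite lee_fin; apply: uT; rewrite le_max lexx orbT.
Unshelve. all: by end_near. Qed.

(** [Cap_safe] is the limit of [cap (t n)] for cutoffs [t n] strictly below the supremum of safe
    scores, and [util_range] is bounded by any bound on [u W - u w0]; the strict inequality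
    therefore survives at some finite [W] and [n]. *)
Lemma capacity_threshold :
  ((cost_d M 1 a0)%:E < util_range M * Cap_safe M)%E ->
  exists W q' q, [/\ w0 <= W, q' < q, safe_scores M q &
    cost_d M 1 a0 < (u W - u w0) * cap q'].
Proof.
move=> hcap; have c0 := cost_d1_gt0 HM; have i2 : (0 < 1 <= 2)%N by [].
have f1i := dens_d_integrable HM i2 act0_in.
(* With no safe score the capacity is an integral over the empty set, so the product is 0; [+oo] is
   excluded because safe scores are nonpositive. *)
case e : (safe_score_sup M) => [b||]; last first.
- move: hcap; rewrite /Cap_safe e (_ : [set y | _] = set0); last first.
    by apply/seteqP; split => // y /=.
  by rewrite integral_set0 oppe0 mule0 lte_fin ltNge ltW.
- have : (safe_score_sup M <= 0)%E.
    by apply: ge_ereal_sup => _ [q [q0 _] <-]; rewrite lee_fin.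
  by rewrite e.
have b0 : b <= 0.
  rewrite -lee_fin -e.
  by apply: ge_ereal_sup => _ [q [q0 _] <-]; rewrite lee_fin.
pose t (n : nat) := b - n.+1%:R^-1.
have tb n : t n < b by rewrite /t gtrBl invr_gt0 ltr0n.
pose F n := [set y | s y <= t n].
have UF : [set y | ((s y)%:E < safe_score_sup M)%E] = \bigcup_n F n.
  rewrite e; apply/seteqP; split => y /=; last first.
    by rewrite lte_fin => -[n _ Fn]; exact: le_lt_trans Fn (tb n).
  rewrite lte_fin => sb.
  have bs : 0 < (b - s y)^-1 by rewrite invr_gt0 subr_gt0.
  exists (Num.bound (b - s y)^-1) => //; rewrite /F/= /t lerBrDr -lerBrDl.
  rewrite invf_ple ?posrE ?subr_gt0 ?ltr0n//.
  by apply: le_trans (ltW (archi_boundP (ltW bs))) _; rewrite ler_nat.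
have sF n y : F n y -> f1 y <= 0.
  by rewrite /F/= -score_le0 => sy; rewrite (le_trans sy)// (le_trans (ltW (tb n))).
have capn n : (- (\int[nu]_(y in F n) (f1 y)%:E) = (cap (t n))%:E)%E.
  have fi : nu.-integrable (F n) (fun y => (f1 y)%:E).
    by apply: integrableS f1i => //; exact: measurable_score_le.
  have pos y : F n y -> (0 <= (- f1 y)%:E)%E by move/sF; rewrite lee_fin oppr_ge0.
  have nE : (\int[nu]_(y in F n) (f1 y)%:E = - (\int[nu]_(y in F n) (- f1 y)%:E))%E.
    rewrite -(integral_ge0N _ pos); apply: eq_integral => y _.
    by rewrite -EFinN opprK.
  have fin : (\int[nu]_(y in F n) (- f1 y)%:E)%E \is a fin_num.
    by rewrite -fin_numN -nE; apply: integrable_fin_num fi; exact: measurable_score_le.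
  by rewrite nE oppeK /Rintegral fineK.
have cvgcap : (cap (t n))%:E @[n --> \oo] --> Cap_safe M.
  rewrite [X in X @ _](_ : _ = fun n => (- (\int[nu]_(y in F n) (f1 y)%:E))%E);
    last by apply/funext => n; rewrite capn.
  rewrite /Cap_safe UF; under eq_integral do rewrite score_mul.
  apply: cvgeN; apply: le0_nondecreasing_set_cvg_integral.
  - move=> m n mn; apply/subsetPset => y /= /le_trans; apply.
    by rewrite /t lerD2l lerN2 lef_pV2 ?posrE ?ltr0n// ler_nat ltnS.
  - by move=> n; exact: measurable_score_le.
  - by move=> n; apply: measurable_funTS; case/integrableP: f1i.
  - by move=> n y /sF; rewrite lee_fin.
have cap0 n : 0 <= cap (t n).
  by apply: Rintegral_ge0 => y /sF; rewrite oppr_ge0.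
have [k Ck] : exists k, Cap_safe M = k%:E.
  exists (fine (Cap_safe M)); rewrite fineK// /Cap_safe UF fin_numN.
  under eq_integral do rewrite score_mul.
  apply: integrable_fin_num; first by apply: bigcupT_measurable => n; exact: measurable_score_le.
  apply: integrableS f1i => //; apply: bigcupT_measurable => n.
  exact: measurable_score_le.
have k_ge x : x < k -> exists n, x < cap (t n).
  move=> xk; apply: contrapT => no; have : (Cap_safe M <= x%:E)%E.
    rewrite -(cvg_lim _ cvgcap)//; apply: lime_le; first exact: cvgP cvgcap.
    apply: nearW => n; rewrite lee_fin leNgt; apply/negP => lt.
    by apply: no; exists n.
  by rewrite Ck lee_fin leNgt xk.
have k0 : 0 < k.
  rewrite lt_neqAle; apply/andP; split.
    by apply/eqP => k0; move: hcap; rewrite Ck -k0 mule0 lte_fin ltNge ltW.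
  rewrite leNgt; apply/negP => kn; have : (Cap_safe M >= 0)%E.
    rewrite -(cvg_lim _ cvgcap)//; apply: lime_ge; first exact: cvgP cvgcap.
    by apply: nearW => n; rewrite lee_fin.
  by rewrite Ck lee_fin leNgt kn.
(* [W] is chosen before [n]: if no wealth worked, [util_range] would be at most [c'(a0) / k],
   against the assumed strict inequality. *)
have [W wW hW] : exists2 W, w0 <= W & cost_d M 1 a0 / k < u W - u w0.
  apply: contrapT => no; move: hcap; rewrite ltNge => /negP; apply.
  have /util_range_le : forall W, w0 <= W -> u W <= cost_d M 1 a0 / k + u w0.
    move=> W wW; rewrite -lerBlDr leNgt; apply/negP => lt.
    by apply: no; exists W.
  rewrite addrK Ck => le.
  apply: le_trans (lee_wpmul2r _ le) _; first by rewrite lee_fin ltW.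
  by rewrite -EFinM divfK// gt_eqF.
have uW : 0 < u W - u w0 by apply: lt_trans hW; exact: divr_gt0.
rewrite ltr_pdivrMr// mulrC -ltr_pdivrMr// in hW.
have [n hn] := k_ge _ hW.
have : ((t n)%:E < safe_score_sup M)%E by rewrite e lte_fin.
move=> /ereal_sup_gt[_ [q sq <-]]; rewrite lte_fin => tq.
exists W, (t n), q; split => //.
by rewrite mulrC -ltr_pdivrMr.
Qed.

End Conditions.

(** * The two alternatives *)

Section Conclusion.
Context {d} {Y : measurableType d} {R : realType} {M : moral_hazard Y R}.
Hypothesis HM : maintained M.
Local Notation nu := (dom_meas M).
Local Notation a0 := (act0 M).
Local Notation u := (util M).
Local Notation w0 := (wealth0 M).
Local Notation s := (score M).
Local Notation f1 y := (dens_d M 1 y a0).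
Local Notation cap q := (\int[nu]_(y in [set y | s y <= q]) (- f1 y)).

Lemma foa_general : general_condition M -> foa_near_sup M.
Proof.
move=> [_ [ARA [cc0 [Cfin /(capacity_threshold HM)]]]].
move=> [W [q' [q2 [wW q'q2 sq2 hW]]]].
have [c0 c0pos cE] := cost_curv_fin cc0.
have [kappa0 hk0] : exists k : R, (Curv_safe M < k%:E)%E.
  have := Curv_safe_ge0 (M := M); move: Cfin; case: (Curv_safe M) => // r _ _.
  by exists (r + 1); rewrite lte_fin ltrDl.
have [q1 sq1 hq1] := Curv_safe_lt hk0.
have kappa_ge0 : 0 <= kappa0.
  rewrite -lee_fin; apply: le_trans (hq1 a0 act0_in); exact: curv_ge0.
(* [q1] controls the curvature and [q2] exceeds [q']; the maximum does both, since raising [q]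
   shrinks the domain of integration. *)
pose q := Num.max q1 q2.
have q'q : q' < q by rewrite lt_max q'q2 orbT.
(* Makes [K * kappa0 / (q - q')] equal to [c0 * kappa0 / (kappa0 + 1)], at most [c0]; the 1 avoids
   dividing by zero. *)
pose K := c0 * (q - q') / (kappa0 + 1).
have qq0 : 0 < q - q' by rewrite subr_gt0.
have k1 : 0 < kappa0 + 1 by rewrite ltr_wpDl.
have Kpos : 0 < K by rewrite divr_gt0// mulr_gt0.
have [W0 wW0 HA] : exists2 W0, w0 <= W0 &
    forall W, W0 < W -> K^-1 <= risk_aversion M W / util_d M 1 W.
  have /cvgryPge/(_ K^-1) := ARA; move=> [X [_ HX]].
  exists (Num.max w0 X); first by rewrite le_max lexx.
  by move=> t; rewrite gt_max => /andP[_ /HX].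
have [z0 lip] := canonical_util_lipschitz HM Kpos wW0 HA.
apply: (foa_below_relaxed_sup HM q'q (safe_max sq1 sq2) (ltW Kpos) kappa_ge0 wW hW
  _ lip) => a Aa.
  apply: le_trans (hq1 a Aa); apply: (curv_mono HM) => //.
  by rewrite le_max lexx.
apply: (@le_trans _ _ c0); last by apply: cost_curv_le => //; rewrite cE.
rewrite ler_pdivrMr// /K mulrAC ler_pdivrMr// mulrC [leLHS]mulrC.
by rewrite ler_wpM2l// ?lerDl// mulr_ge0// ltW.
Qed.

(** The threshold makes [W] both interior to [wealths] and positive, so the derivative of [ln] is
    available. *)
Lemma log_util_d1 W : (forall W, wealths M W -> u W = ln W) ->
  Num.max w0 1 < W -> util_d M 1 W = W^-1.
Proof.
move=> uln; rewrite gt_max => /andP[wW W1].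
have Wpos : 0 < W := lt_trans ltr01 W1.
have h1 := is_derive1_ln Wpos.
have h2 : is_derive W 1 (@ln R) (util_d M 1 W).
  apply: near_eq_is_derive (util_derive HM wW).
  by apply: filterS (lt_nbhsr wW) => t wt; rewrite uln// wealthsE ltW.
by rewrite -(@derive_val _ _ _ _ _ _ _ h1) -(@derive_val _ _ _ _ _ _ _ h2).
Qed.

Lemma log_util_d2 W : (forall W, wealths M W -> u W = ln W) ->
  Num.max w0 1 < W -> util_d M 2 W = - W ^- 2.
Proof.
move=> uln W1; have := W1; rewrite gt_max => /andP[wW W1'].
have W0 : W != 0 by rewrite gt_eqF// (lt_trans ltr01).
have h1 : is_derive W 1 (fun W : R => W^-1) (- W ^- 2).
  by have := is_deriveV W0 (is_derive_id W 1); rewrite [_ *: _]mulr1.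
have h2 : is_derive W 1 (fun W : R => W^-1) (util_d M 2 W).
  apply: near_eq_is_derive (util_d1_derive HM wW).
  by apply: filterS (lt_nbhsr W1) => t wt; rewrite log_util_d1.
by rewrite -(@derive_val _ _ _ _ _ _ _ h1) -(@derive_val _ _ _ _ _ _ _ h2).
Qed.

(** If the capacity were 0, [f_a] would vanish almost everywhere on the scores up to [q], although
    it is negative there. That region would be null and [q] an essential lower bound. *)
Lemma cap_gt0 q : q < 0 -> (ess_inf nu (EFin \o s) < q%:E)%E -> 0 < cap q.
Proof.
move=> q0 ess; have mD := measurable_score_le HM q.
have f1i := dens_d_integrable HM (isT : (0 < 1 <= 2)%N) act0_in.
rewrite ltNge; apply/negP; rewrite Rintegral_mkcond.
set g := (X in \int[nu]_y X y) => g0.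
have gi : nu.-integrable [set: Y] (fun y => (g y)%:E).
  have : nu.-integrable [set y | s y <= q] (fun y => (- f1 y)%:E).
    apply: (@integrableS _ _ _ nu setT) => //.
    by have := integrable_realZ (-1) f1i; apply: eq_integrable => // y _; rewrite mulN1r.
  move=> /(integrable_mkcond _ mD); apply: eq_integrable => // y _.
  by rewrite /g/= /patch; case: (_ \in _).
have zi : nu.-integrable [set: Y] (fun y => (0 : R)%:E) by exact: integrable0.
have gge0 y : 0 <= g y.
  rewrite /g /patch; case: ifPn => // /set_mem/= sq.
  by rewrite oppr_ge0 -score_le0 (le_trans sq)// ltW.
have I0 : \int[nu]_y g y <= \int[nu]_(y in setT) (0 : R).
  by rewrite [leRHS]Rintegral_cst// mul0r.
have ae := Rintegral_eq_ae zi gi gge0 I0.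
move: ess; rewrite ltNge => /negP; apply; apply/ess_infP.
apply: filterS ae => y /= gy; rewrite lee_fin leNgt; apply/negP => sq.
have f10 : f1 y = 0.
  move: gy; rewrite /g /patch mem_set; last exact: ltW.
  by move=> /eqP; rewrite eq_sym oppr_eq0 => /eqP.
have := score_mul (M := M) y; rewrite f10 => /eqP.
by rewrite mulf_eq0 (gt_eqF (dens0_gt0 y)) orbF (lt_eqF (lt_trans sq q0)).
Qed.

Lemma log_width_threshold : (curv_width_ratio M < cost_curv M)%E ->
  exists k c0 : R, [/\ (Curv_safe M < k%:E)%E, 0 <= k, 0 < c0,
    cost_curv M = c0%:E & ((k / c0)%:E < Width_safe M)%E].
Proof.
have W0 : (0 <= Width_safe M)%E by apply: ereal_sup_ubound; left.
have := Curv_safe_ge0 (M := M); rewrite /curv_width_ratio.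
case: (Curv_safe M) => [k||]//; last by move=> _; rewrite /= ltNge leey.
rewrite lee_fin => k0; rewrite /=.
have [e|ne] := eqVneq (Width_safe M) 0%E; first by rewrite ltNge leey.
case e : (Width_safe M) ne W0 => [w||]//=.
- rewrite eqe => w0' wge; have wpos : 0 < w by rewrite lt_neqAle eq_sym w0'.
  move=> /cost_curv_fin[c0 kc cE]; rewrite ltr_pdivrMr// in kc.
  have c0pos : 0 < c0.
    by rewrite -(pmulr_lgt0 _ wpos) (le_lt_trans k0).
  (* The midpoint of the strict inequality [k < c0 * w] leaves room on both sides. *)
  exists ((k + c0 * w) / 2), c0; split => //.
  + by rewrite lte_fin; lra.
  + by lra.
  + by rewrite lte_fin ltr_pdivrMr// mulrC; lra.
- move=> _ _ /cost_curv_fin[c0 c0pos cE].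
  exists (k + 1), c0; split => //; first by rewrite lte_fin ltrDl.
  + by rewrite addr_ge0.
  + by rewrite ltry.
Qed.

Lemma foa_log : log_condition M -> foa_near_sup M.
Proof.
move=> [uln /log_width_threshold[kappa [c0 [hk kappa_ge0 c0pos cE hw]]]].
have [q1 sq1 hq1] := Curv_safe_lt hk.
set om := kappa / c0 in hw; have om0 : 0 <= om by rewrite divr_ge0// ltW.
(* The width exceeds [om], so some safe [q2] lies more than [om] above the essential infimum of the
   score, and [q'] fits in between. *)
have [q2 [q' [sq2 q'q2 ess]]] : exists q2 q', [/\ safe_scores M q2, q' < q2 - om &
    (ess_inf nu (EFin \o s) < q'%:E)%E].
  have /ereal_sup_gt[x] := hw; case=> [->|[q2 sq2 <-]] lt.
    by move: lt; rewrite lte_fin ltNge om0.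
  move: lt; case: (ess_inf _ _) => [e||]//.
    rewrite -EFinB lte_fin => lt; exists q2, ((e + (q2 - om)) / 2).
    by split => //; rewrite ?lte_fin; lra.
  by move=> _; exists q2, (q2 - om - 1); split => //; [lra|rewrite ltNyr].
pose q := Num.max q1 q2.
have q2q : q2 <= q by rewrite le_max lexx orbT.
have qq' : om < q - q' by lra.
have q'q : q' < q by lra.
have q'0 : q' < 0 by have [q20 _] := sq2; lra.
have capq := cap_gt0 q'0 ess.
(* Log utility is unbounded, so any positive capacity suffices at a high enough wealth; the 1 makes
   the inequality strict. *)
pose T := cost_d M 1 a0 / cap q' + u w0 + 1.
pose W := Num.max w0 (expR T).
have wW : w0 <= W by rewrite le_max lexx.
have hW : cost_d M 1 a0 < (u W - u w0) * cap q'.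
  rewrite -ltr_pdivrMr//; have : T <= u W.
    rewrite uln ?wealthsE// -[leLHS]expRK ler_ln ?posrE ?expR_gt0//.
      by rewrite le_max lexx orbT.
    by rewrite lt_max expR_gt0 orbT.
  by rewrite /T; lra.
have wW0 : w0 <= Num.max w0 1 by rewrite le_max lexx.
(* For log utility risk aversion and marginal utility are both [1/t], so the ratio is exactly 1 and
   [K = 1]. *)
have HA t : Num.max w0 1 < t -> 1^-1 <= risk_aversion M t / util_d M 1 t.
  move=> wt; have t0 : 0 < t.
    by apply: lt_trans wt; rewrite lt_max ltr01 orbT.
  rewrite /risk_aversion log_util_d1// log_util_d2//.
  rewrite le_eqVlt; apply/orP; left; apply/eqP.
  by field; exact: lt0r_neq0.
have [z0 lip] := canonical_util_lipschitz HM ltr01 wW0 HA.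
apply: (foa_below_relaxed_sup HM q'q (safe_max sq1 sq2) ler01 kappa_ge0 wW hW
  _ lip) => a Aa.
  apply: le_trans (hq1 a Aa); apply: (curv_mono HM) => //.
  by rewrite le_max lexx.
apply: (@le_trans _ _ c0); last by apply: cost_curv_le => //; rewrite cE.
rewrite mul1r ler_pdivrMr ?subr_gt0// mulrC -ler_pdivrMr//.
exact: ltW.
Qed.

End Conclusion.

Unset Implicit Arguments.

Theorem theorem1 (d : measure_display) (Y : measurableType d) (R : realType)
    (M : moral_hazard Y R) (HM : maintained M)
    (Hcond : general_condition M \/ log_condition M) :
  exists Ustar : R, (Ustar%:E < relaxed_sup M)%E /\
    forall Ubar : R, Ustar <= Ubar -> (Ubar%:E < relaxed_sup M)%E ->
      foa_valid M Ubar /\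
      exists (w : Y -> R) (lambda mu : R),
        [/\ relaxed_solution M Ubar w,
            forall v, relaxed_solution M Ubar v ->
              \forall y \ae dom_meas M, v y = w y,
            0 <= lambda &
            \forall y \ae dom_meas M, w y = canonical_contract M lambda mu y].
Proof. by case: Hcond => [/(foa_general HM)|/(foa_log HM)]. Qed.
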